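(* Let $(M,\Omega)$ be a $2n$-dimensional symplectic manifold and let $\nabla$ be a symplectic connection on $(M,\Omega)$. Then $\nabla$ is Weyl flat if and only if there is a symmetric covariant two-tensor $A_{ij}=A_{(ij)}$ on $M$ such that for every $p\in M$ and every two-dimensional symplectic subspace $L\subset T_pM$ there holds $\mathscr{K}_{p,L}(Z)=4A(Z,Z)$ whenever $Z\in L$. Moreover, if this is the case, then $2(n+1)A_{ij}=R_{ij}$, where $R_{ij}$ is the Ricci tensor of $\nabla$.
   Context: $M$ is smooth and connected, of dimension $2n\ge 2$. Abstract index notation with the summation convention is used; parentheses (brackets) around indices denote normalized complete symmetrization (antisymmetrization), e.g. $a_{(ij)}=\tfrac12(a_{ij}+a_{ji})$. An affine connection $\nabla$ on $(M,\Omega)$ is symplectic if it is torsion-free and $\nabla\Omega=0$. Its curvature is $R(X,Y)Z=\nabla_X\nabla_YZ-\nabla_Y\nabla_XZ-\nabla_{[X,Y]}Z$, in indices $2\nabla_{[i}\nabla_{j]}X^k=R_{ijp}{}^kX^p$. Set $R_{ijkl}=R_{ijk}{}^p\Omega_{pl}$, so $X^iY^jZ^kU^lR_{ijkl}=\Omega(R(X,Y)Z,U)$; this is symmetric in $k,l$. The Ricci tensor is $R_{ij}=R_{pij}{}^p$ (it is symmetric). The symplectic Weyl tensor is $$W_{ijkl}=R_{ijkl}-\tfrac{1}{n+1}\left(\Omega_{i(k}R_{l)j}-\Omega_{j(k}R_{l)i}+\Omega_{ij}R_{kl}\right),$$ and $\nabla$ is Weyl flat if $W_{ijkl}=0$.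 A two-dimensional subspace $L\subset T_pM$ is symplectic if $\Omega|_L$ is nondegenerate. For such $L$ the quadratic form $\mathscr{K}_{p,L}$ on $T_pM$ is $$\mathscr{K}_{p,L}(Z)=\frac{X^iY^jZ^kZ^lR_{ijkl}}{X^iY^j\Omega_{ij}}=\frac{\Omega(R(X,Y)Z,Z)}{\Omega(X,Y)},$$ for any basis $X,Y$ of $L$ (it does not depend on the choice of basis). *)

(* Defs.v *)
From HB Require Import structures.
From mathcomp Require Import all_boot all_order all_algebra.
From mathcomp Require Import all_classical all_reals all_analysis.
Import Order.TTheory GRing.Theory Num.Theory.
Import numFieldNormedType.Exports.

Set Implicit Arguments.
Unset Strict Implicit.
Unset Printing Implicit Defensive.

Local Open Scope classical_set_scope.
Local Open Scope ring_scope.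

(* C^oo on an open set: every iterated directional derivative
   D_(v_1) (... (D_(v_k) f)) is Frechet differentiable at every point of the
   set (in particular every such derivative exists and is continuous there). *)
Definition smooth_on (R : realType) (V W : normedModType R) (U : set V)
    (f : V -> W) : Prop :=
  forall (s : seq V) (x : V), U x ->
    differentiable (foldr (fun v g => 'D_v g) f s) x.

(* Smooth manifold of dimension m, given by a smooth atlas. Charts and their
   inverses are total functions, meaningful on [dom i] and on its image only.
   [chart_at p] selects one chart around each point p. *)
Record smooth_manifold (R : realType) (m : nat) := SmoothManifold {
  point :> topologicalType;
  index : Type;
  dom : index -> set point;
  chart : index -> point -> 'rV[R]_m;
  chart_inv : index -> 'rV[R]_m -> point;
  chart_at : point -> index;
  manifold_hausdorff : hausdorff_space point;
  manifold_second_countable : @second_countable point;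
  dom_open : forall i, open (dom i);
  image_open : forall i, open (chart i @` dom i);
  chartK : forall i p, dom i p -> chart_inv i (chart i p) = p;
  chart_continuous : forall i p, dom i p -> {for p, continuous (chart i)};
  chart_inv_continuous : forall i x, (chart i @` dom i) x ->
    {for x, continuous (chart_inv i)};
  transition_smooth : forall i j,
    smooth_on (chart i @` (dom i `&` dom j)) (chart j \o chart_inv i);
  chart_at_dom : forall p, dom (chart_at p) p }.

Section Fields.
Variables (R : realType) (m : nat) (M : smooth_manifold R m).

(* T_pM is identified with R^m through the differential at p of the chart
   [chart_at p]. A tangent vector at p is thus an element of 'rV_m, and
   its components in another chart i around p are obtained by applying the
   differential of [chart i \o chart_inv (chart_at p)]. *)
Local Notation E := 'rV[R]_m.

Definition vfield : Type := M -> E.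

Definition coord_vfield (i : index M) (X : vfield) : E -> E := fun x =>
  let p := chart_inv i x in let j := chart_at p in
  'D_(X p) (chart i \o chart_inv j) (chart j p).

Definition smooth_fun (U : set M) (f : M -> R) : Prop :=
  forall i : index M,
    smooth_on (chart i @` (U `&` dom i)) (f \o chart_inv i).

Definition smooth_vfield (U : set M) (X : vfield) : Prop :=
  forall i : index M,
    smooth_on (chart i @` (U `&` dom i)) (coord_vfield i X).

(* X(f) *)
Definition der (X : vfield) (f : M -> R) : M -> R := fun p =>
  let i := chart_at p in 'D_(X p) (f \o chart_inv i) (chart i p).

(* Lie bracket: [X, Y]^k = X^i d_i Y^k - Y^i d_i X^k *)
Definition bracket (X Y : vfield) : vfield := fun p =>
  let i := chart_at p in
  'D_(X p) (coord_vfield i Y) (chart i p)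
  - 'D_(Y p) (coord_vfield i X) (chart i p).

(* The vector field on [dom (chart_at p)] with constant components in the chart
   [chart_at p] and value v at p. *)
Definition const_vfield (p : M) (v : E) : vfield := fun q =>
  let i := chart_at p in
  'D_v (chart (chart_at q) \o chart_inv i) (chart i q).

Record tensor2 := Tensor2 {
  tensor2_form :> M -> {biscalar E};
  tensor2_smooth : forall (U : set M) (X Y : vfield), open U ->
    smooth_vfield U X -> smooth_vfield U Y ->
    smooth_fun U (fun p => tensor2_form p (X p) (Y p)) }.

Definition symmetric2 (A : tensor2) : Prop := forall p X Y, A p X Y = A p Y X.

(* Koszul's axioms, for the covariant derivative of vector fields on arbitrary
   open subsets. As vector fields are total functions, a local vector field is
   a total one that is smooth on the open set; the values of [nabla X Y] at
   points near which X or Y is not smooth are irrelevant. *)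
Record connection := Connection {
  nabla :> vfield -> vfield -> vfield;
  nabla_smooth : forall (U : set M) X Y, open U ->
    smooth_vfield U X -> smooth_vfield U Y -> smooth_vfield U (nabla X Y);
  nabla_local : forall (U : set M) X X' Y Y', open U ->
    smooth_vfield U X -> smooth_vfield U Y ->
    (forall p, U p -> X p = X' p) -> (forall p, U p -> Y p = Y' p) ->
    forall p, U p -> nabla X Y p = nabla X' Y' p;
  nabla_linear : forall (U : set M) f X X' Y, open U -> smooth_fun U f ->
    smooth_vfield U X -> smooth_vfield U X' -> smooth_vfield U Y ->
    forall p, U p ->
      nabla (fun q => f q *: X q + X' q) Y p
      = f p *: nabla X Y p + nabla X' Y p;
  nabla_additive : forall (U : set M) X Y Y', open U ->
    smooth_vfield U X -> smooth_vfield U Y -> smooth_vfield U Y' ->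
    forall p, U p ->
      nabla X (fun q => Y q + Y' q) p = nabla X Y p + nabla X Y' p;
  nabla_leibniz : forall (U : set M) f X Y, open U -> smooth_fun U f ->
    smooth_vfield U X -> smooth_vfield U Y ->
    forall p, U p ->
      nabla X (fun q => f q *: Y q) p = der X f p *: Y p + f p *: nabla X Y p }.

Definition torsion_free (D : connection) : Prop :=
  forall (U : set M) X Y, open U -> smooth_vfield U X -> smooth_vfield U Y ->
    forall p, U p -> D X Y p - D Y X p = bracket X Y p.

Definition parallel (D : connection) (A : tensor2) : Prop :=
  forall (U : set M) X Y Z, open U ->
    smooth_vfield U X -> smooth_vfield U Y -> smooth_vfield U Z ->
    forall p, U p ->
      der X (fun q => A q (Y q) (Z q)) p
      - A p (D X Y p) (Z p) - A p (Y p) (D X Z p) = 0.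

(* dA = 0 for a two-form A *)
Definition closed2 (A : tensor2) : Prop :=
  forall (U : set M) X Y Z, open U ->
    smooth_vfield U X -> smooth_vfield U Y -> smooth_vfield U Z ->
    forall p, U p ->
      der X (fun q => A q (Y q) (Z q)) p
      - der Y (fun q => A q (X q) (Z q)) p
      + der Z (fun q => A q (X q) (Y q)) p
      - A p (bracket X Y p) (Z p)
      + A p (bracket X Z p) (Y p)
      - A p (bracket Y Z p) (X p) = 0.

Definition symplectic_form (Om : tensor2) : Prop :=
  [/\ forall p X, Om p X X = 0,
      forall p X, (forall Y, Om p X Y = 0) -> X = 0
    & closed2 Om].

Definition symplectic_connection (Om : tensor2) (D : connection) : Prop :=
  torsion_free D /\ parallel D Om.

Definition curvature_field (D : connection) (X Y Z : vfield) : vfield :=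
  fun p => D X (D Y Z) p - D Y (D X Z) p - D (bracket X Y) Z p.

(* R(x, y) z for x, y, z in T_pM. By tensoriality the value at p does not
   depend on the extension of x, y, z to vector fields near p; the constant
   extensions are the ones used here. *)
Definition curvature (D : connection) (p : M) (x y z : E) : E :=
  curvature_field D (const_vfield p x) (const_vfield p y) (const_vfield p z) p.

(* R_ij = R_pij^p, the trace of z |-> R(z, x) y *)
Definition ricci (D : connection) (p : M) (x y : E) : R :=
  \sum_(k < m) curvature D p (delta_mx 0 k) x y 0 k.

(* R_ijkl *)
Definition curvature4 (Om : tensor2) (D : connection) (p : M)
    (x y z u : E) : R :=
  Om p (curvature D p x y z) u.

Definition symplectic_subspace (Om : tensor2) (p : M) (L : {vspace E}) : Prop :=
  forall x, x \in L -> (forall y, y \in L -> Om p x y = 0) -> x = 0.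

(* The quadratic form K_{p,L} for \dim L = 2; the basis [vbasis L] can be
   replaced with any other one. *)
Definition sectional (Om : tensor2) (D : connection) (p : M) (L : {vspace E})
    (z : E) : R :=
  let x := (vbasis L)`_0 in let y := (vbasis L)`_1 in
  curvature4 Om D p x y z z / Om p x y.

End Fields.

Section Weyl.
Variables (R : realType) (n : nat) (M : smooth_manifold R (2 * n)).
Variables (Om : tensor2 M) (D : connection M).

Definition weyl (p : M) (x y z u : 'rV[R]_(2 * n)) : R :=
  let Ric := ricci D p in
  curvature4 Om D p x y z u
  - (n.+1)%:R^-1 *
    (2^-1 * (Om p x z * Ric u y + Om p x u * Ric z y)
     - 2^-1 * (Om p y z * Ric u x + Om p y u * Ric z x)
     + Om p x y * Ric z u).

Definition weyl_flat : Prop := forall p x y z u, weyl p x y z u = 0.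

End Weyl.

(* Main.v *)
Require Import Defs.
From HB Require Import structures.
From mathcomp Require Import all_boot all_order all_algebra.
From mathcomp Require Import all_classical all_reals all_analysis.
From mathcomp Require Import ring lra.
Import Order.TTheory GRing.Theory Num.Theory.
Import numFieldNormedType.Exports.
Local Open Scope classical_set_scope.
Local Open Scope ring_scope.

(** At each point the theorem is linear algebra, once the curvature is known to
    have three symmetries: R_ijkl is skew in i, j; it satisfies the first Bianchi
    identity in i, j, k; and it is symmetric in k, l.

    If W = 0 and Z lies in the span of X and Y, then the formula for R_ijkl in terms
    of the Ricci tensor gives Om(R(X, Y) Z, Z) = 2 / (n + 1) Om(X, Y) Ric(Z, Z),
    and A = Ric / (2 (n + 1)) has the required property
    ([sectional_of_weyl_flat]).  Conversely, taking Z = X gives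
    Om(R(X, Y) X, X) = 4 Om(X, Y) A(X, X) when Om(X, Y) is nonzero, hence always,
    by linearity in Y ([curv4_diag]).  Polarization in X yields the
    symmetrization of R_ijkl over i, k, l, and by the three symmetries the part of
    this symmetrization that is skew in i, j is a nonzero multiple of R_ijkl
    ([curv4_formula]).  This expresses R_ijkl through Om and A; the
    trace of the formula is Ric = 2 (n + 1) A ([ric_formula]), and with this
    value of A it is the equation W = 0 ([weyl_flat_of_sectional]).

    The analytic part of the proof supplies the symmetries and the smoothness of
    A.  The Bianchi identity follows from the absence of torsion
    ([bianchi]), the symmetry in k, l from the parallelism of Om
    ([curvature_skew]); together they make the Ricci tensor symmetric
    ([ricci_sym]).  All of this, and the multilinearity of the curvature, uses
    that the commutator of two vector fields acting on functions is their bracket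
    ([der_bracket]), which is the symmetry of second derivatives
    ([derive_comm]).  Since the curvature and the Ricci tensor are computed at
    each point in a chart chosen for that point, with no continuity in the choice,
    smoothness of the Ricci tensor requires that the curvature operator on
    arbitrary vector fields depends only on their values at the point
    ([curvature_fieldE]) and that the trace does not depend on the chart
    ([trace_conj]). *)

Set Implicit Arguments.
Unset Strict Implicit.
Unset Printing Implicit Defensive.

(** * Germs and symmetry of second derivatives *)

Section Germs.
Variables (R : realType) (V W : normedModType R).

Lemma near_eq_differentiable (f g : V -> W) (a : V) :
  (\near a, f a = g a) -> differentiable f a -> differentiable g a.
Proof.
move=> fg df.
have e : g \o shift a = cst (g a) + 'd f a +o_ 0 id.
  apply/eqaddoP => _/posnumP[eps].
  have /eqaddoP/(_ _ (gt0 eps)) fo := diff_locally df.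
  near=> y.
  have -> : (g \o shift a - (cst (g a) + 'd f a)) y
            = (f \o shift a - (cst (f a) + 'd f a)) y.
    rewrite !fctE /= -(nbhs_singleton fg); congr (_ - _).
    apply/esym; near: y.
    by have := fg; rewrite [X in X -> _](near_shift 0) subr0.
  by near: y; exact: fo.
have cf : continuous ('d f a) by exact: diff_continuous.
by apply/diff_locallyP; rewrite (diff_unique cf e).
Unshelve. all: by end_near. Qed.

End Germs.

Section Schwarz.
Variables (R : realType) (V : normedModType R).
Implicit Types (f : V -> R) (x u v : V).

Let sdiff f x u v (h : R) :=
  f (h *: u + h *: v + x) - f (h *: u + x) - f (h *: v + x) + f x.

Lemma differentiable_expand (F : V -> R) x (e : R) : 0 < e ->
  differentiable F x ->
  exists2 d : R, 0 < d & forall w, `|w| < d ->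
    `|F (w + x) - F x - 'd F x w| <= e * `|w|.
Proof.
move=> e0 /diff_locally/eqaddoP/(_ _ e0); rewrite nearE.
move=> /nbhs_ballP[d /= d0 dP]; exists d => // w wd.
have := dP w; rewrite /= -ball_normE /= sub0r normrN => /(_ wd).
by rewrite !fctE /= opprD addrA.
Qed.

Lemma derive_line f x u w (t : R) : differentiable f (t *: u + w) ->
  is_derive t 1 (fun s : R => f (s *: u + w)) ('D_u f (t *: u + w)).
Proof.
move=> df.
have dl : is_diff t (fun s : R => s *: u + w) (fun s => s *: u).
  have -> : (fun s : R => s *: u + w) = ( *:%R^~ u : R -> V) + cst w by [].
  by apply: is_diff_eq; rewrite addr0.
have dd : differentiable (f \o (fun s : R => s *: u + w)) t.
  by apply: differentiable_comp.
apply: DeriveDef; first exact: diff_derivable.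
rewrite deriveE // diff_comp //= diff_val scale1r.
by rewrite deriveE.
Qed.

(** The mean value theorem in the direction u writes the second difference as
    h times an increment of ['D_u f] in the direction v; differentiability of
    ['D_u f] at x alone then gives its leading term. *)
Lemma second_difference f x u v (e : R) : 0 < e ->
  (\forall y \near x, differentiable f y) -> differentiable ('D_u f) x ->
  exists2 d : R, 0 < d & forall h, 0 < h -> h < d ->
    `|sdiff f x u v h - h ^+ 2 * 'D_v ('D_u f) x| <= e * h ^+ 2.
Proof.
move=> e0 df dF.
(* K bounds the sizes, divided by h, of the two increments compared below. *)
pose K := 2 * (`|u| + `|v|) + 1.
have K0 : 0 < K by rewrite ltr_wpDl// mulr_ge0// addr_ge0.
have [d1 d10 d1P] := differentiable_expand (divr_gt0 e0 K0) dF.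
move: df => /nbhs_ballP[d2 /= d20 d2P].
pose d := Num.min d1 d2 / K.
have d0 : 0 < d by rewrite divr_gt0// lt_min d10.
exists d => // h h0 hd.
have hK : h * K < Num.min d1 d2 by rewrite -ltr_pdivlMr.
have hK1 : h * K < d1 by rewrite (lt_le_trans hK)// ge_min lexx.
have hK2 : h * K < d2 by rewrite (lt_le_trans hK)// ge_min lexx orbT.
have small (s t : R) : 0 <= s <= h -> 0 <= t <= h ->
    `|s *: u + t *: v| <= h * (`|u| + `|v|).
  move=> /andP[s0 sh] /andP[t0 th]; rewrite (le_trans (ler_normD _ _))//.
  by rewrite !normrZ !ger0_norm// mulrDr lerD// ler_wpM2r.
have hKu : h * (`|u| + `|v|) < h * K.
  by rewrite ltr_pM2l// /K mulr2n mulrDl mul1r -addrA ltrDl ltr_wpDl// addr_ge0.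
pose g (t : R) := f (t *: u + (h *: v + x)) - f (t *: u + x).
pose dg (t : R) := 'D_u f (t *: u + (h *: v + x)) - 'D_u f (t *: u + x).
have dfy (s t : R) : 0 <= s <= h -> 0 <= t <= h ->
    differentiable f (s *: u + (t *: v + x)).
  move=> hs ht; apply: d2P; rewrite -ball_normE /= addrA distrC addrK.
  by rewrite (le_lt_trans (small _ _ hs ht))// (lt_trans hKu).
have h0h : 0 <= h <= h by rewrite ltW//= lexx.
have h00 : 0 <= (0 : R) <= h by rewrite lexx ltW.
have gd t : 0 <= t <= h -> is_derive t 1 g (dg t).
  move=> ht; have := dfy _ _ ht h00; rewrite scale0r add0r => d'.
  by apply: is_deriveB; apply: derive_line => //; exact: dfy.
have [c] : exists2 c, c \in `]0, h[ & g h - g 0 = dg c * (h - 0).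
  apply: MVT => //.
    move=> t; rewrite in_itv/= => /andP[t0 th]; apply: gd.
    by rewrite !ltW.
  apply: derivable_within_continuous => t; rewrite in_itv/= => ht.
  by have [] := gd _ ht.
rewrite in_itv/= subr0 => /andP[c0 ch] gE.
have -> : sdiff f x u v h = g h - g 0.
  by rewrite /sdiff /g !scale0r !add0r !addrA; ring.
have hc : 0 <= c <= h by rewrite !ltW.
rewrite gE deriveE// /dg.
have P1 := d1P (c *: u + h *: v).
have P2 := d1P (c *: u + 0 *: v).
have {}P1 := P1 (le_lt_trans (small _ _ hc h0h) (lt_trans hKu hK1)).
have {}P2 := P2 (le_lt_trans (small _ _ hc h00) (lt_trans hKu hK1)).
rewrite scale0r addr0 in P2.
have s2 := small _ _ hc h00; rewrite scale0r addr0 in s2.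
rewrite addrA.
set A := 'D_u f (c *: u + h *: v + x) in P1 *.
set B := 'D_u f (c *: u + x) in P2 *.
set F0 := 'D_u f x in P1 P2 *.
rewrite linearD !linearZ /= in P1; rewrite linearZ /= in P2.
set du := 'd _ x u in P1 P2; set dv := 'd _ x v in P1 *.
have -> : (A - B) * h - h ^+ 2 * dv =
   h * ((A - F0 - (c *: du + h *: dv)) - (B - F0 - c *: du)).
  rewrite /GRing.scale /=; ring.
rewrite normrM gtr0_norm// expr2 [leRHS]mulrCA ler_pM2l//.
rewrite (le_trans (ler_normB _ _))// (le_trans (lerD P1 P2))//.
rewrite -mulrDr mulrAC -mulrA ler_pM2l// ler_pdivrMr//.
rewrite (le_trans (lerD (small _ _ hc h0h) s2))//.
rewrite -mulrDr ler_pM2l// /K mulr2n mulrDl mul1r.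
by rewrite lerDl.
Qed.

(** The second difference is symmetric in its two directions, and both iterated
    derivatives are the limit of its quotient by [h ^+ 2]. *)
Lemma derive_comm f x u v : (\forall y \near x, differentiable f y) ->
  differentiable ('D_u f) x -> differentiable ('D_v f) x ->
  'D_u ('D_v f) x = 'D_v ('D_u f) x.
Proof.
move=> df du dv; apply/eqP; rewrite -subr_eq0 -normr_le0.
apply/ler_addgt0Pr => e e0; rewrite add0r.
have e2 : 0 < e / 2 by rewrite divr_gt0.
have [d1 d10 P1] := second_difference v e2 df du.
have [d2 d20 P2] := second_difference u e2 df dv.
pose h := Num.min d1 d2 / 2.
have m0 : 0 < Num.min d1 d2 by rewrite lt_min d10.
have h0 : 0 < h by rewrite divr_gt0.
have hm : h < Num.min d1 d2 by rewrite ltr_pdivrMr// ltr_pMr// ltr1n.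
have {}P1 := P1 h h0 (lt_le_trans hm _); have {}P2 := P2 h h0 (lt_le_trans hm _).
have {}P1 := P1 ltac:(by rewrite ge_min lexx).
have {}P2 := P2 ltac:(by rewrite ge_min lexx orbT).
have sC : sdiff f x v u h = sdiff f x u v h.
  by rewrite /sdiff [h *: v + _]addrC; congr (_ + _); rewrite addrAC.
rewrite sC in P2.
move: (sdiff _ _ _ _ _) ('D_u _ x) ('D_v _ x) P1 P2 => S a b P1 P2.
rewrite -(ler_pM2r (exprn_gt0 2 h0)).
have -> : `|a - b| * h ^+ 2 = `|(S - h ^+ 2 * b) - (S - h ^+ 2 * a)|.
  rewrite -[h ^+ 2 in LHS]ger0_norm ?exprn_ge0 ?ltW// -normrM; congr (`|_|).
  ring.
rewrite (le_trans (ler_normB _ _))// (le_trans (lerD P1 P2))//.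
by rewrite -mulrDl -splitr.
Qed.

End Schwarz.

(** * Calculus of smooth functions *)

Section Ck.
Variables (R : realType) (V : normedModType R).

(** Closure of [smooth_on] under an operation that obeys a
    product or chain rule is not an induction on the list of directions, because
    the rule produces derivatives along other lists; it is an induction on the
    order k. *)
Fixpoint Ck (W : normedModType R) (k : nat) (U : set V) (f : V -> W) : Prop :=
  (forall x, U x -> differentiable f x) /\
  (if k is k'.+1 then forall v, Ck k' U ('D_v f) else True).

Lemma open_near (U : set V) x : open U -> U x -> \forall y \near x, U y.
Proof. by move=> oU Ux; apply: open_nbhs_nbhs. Qed.

Section Gen.
Variable W : normedModType R.
Implicit Types (f g : V -> W) (U : set V).

Lemma Ck_diff k U f : Ck k U f -> forall x, U x -> differentiable f x.
Proof. by case: k => [|k] []. Qed.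

Lemma smooth_on_diff U f x : smooth_on U f -> U x -> differentiable f x.
Proof. by move=> fU Ux; exact: (fU [::]). Qed.

Lemma smooth_on_derive U f v : smooth_on U f -> smooth_on U ('D_v f).
Proof. by move=> fU s x Ux; have := fU (rcons s v) x Ux; rewrite foldr_rcons. Qed.

Lemma smooth_onP U f : smooth_on U f <-> forall k, Ck k U f.
Proof.
split=> [fU k|].
  elim: k f fU => [|k IH] f fU; split=> //; try by move=> x; exact: smooth_on_diff.
  by move=> v; apply/IH/smooth_on_derive.
move=> + s; elim/last_ind: s f => [|s v IH] f fU x Ux.
  exact: (Ck_diff (fU 0%N)).
by rewrite foldr_rcons; apply: IH => // k; exact: (fU k.+1).2.
Qed.

Lemma Ck_eq k U f g : open U -> (forall x, U x -> f x = g x) ->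
  Ck k U f -> Ck k U g.
Proof.
move=> oU; have nf (h1 h2 : V -> W) x : (forall x, U x -> h1 x = h2 x) ->
    U x -> \near x, h1 x = h2 x.
  by move=> e Ux; near do (apply: e); apply: open_near.
elim: k f g => [|k IH] f g e [df hf]; split=> //;
  try by move=> x Ux; apply: (near_eq_differentiable (nf _ _ _ e Ux)); exact: df.
move=> v; apply: (IH _ _ _ (hf v)) => x Ux; apply: near_eq_derive; exact: nf Ux.
Unshelve. all: by end_near. Qed.

Lemma Ck_sub k U U' f : U' `<=` U -> Ck k U f -> Ck k U' f.
Proof.
move=> UU; elim: k f => [|k IH] f [df hf]; split=> //;
  try by move=> x /UU; exact: df.
by move=> v; exact/IH/hf.
Qed.

Lemma CkW k U f : Ck k.+1 U f -> Ck k U f.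
Proof.
elim: k f => [|k IH] f [df hf]; split=> // v; exact/IH/hf.
Qed.

Lemma Ck_cst k U (w : W) : Ck k U (cst w).
Proof.
elim: k w => [|k IH] w; split=> // v.
rewrite (_ : 'D_v _ = cst 0)//; apply/funext => x; exact: derive_cst.
Qed.

Lemma Ck_add k U f g : open U -> Ck k U f -> Ck k U g ->
  Ck k U (fun x => f x + g x).
Proof.
move=> oU; elim: k f g => [|k IH] f g [df hf] [dg hg]; split=> //;
  try by move=> x Ux; apply: differentiableD; [exact: df|exact: dg].
move=> v; apply: (Ck_eq oU _ (IH _ _ (hf v) (hg v))) => x Ux.
by rewrite -deriveD//; apply: diff_derivable; [exact: df|exact: dg].
Qed.

Lemma Ck_sum k U n (f : 'I_n -> V -> W) : open U -> (forall i, Ck k U (f i)) ->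
  Ck k U (fun x => \sum_i f i x).
Proof.
move=> oU; elim: n f => [|n IH] f hf.
  by rewrite (_ : (fun _ => _) = cst 0); [exact: Ck_cst|apply/funext=> x; rewrite big_ord0].
rewrite (_ : (fun _ => _) = fun x => \sum_(i < n) f (widen_ord (leqnSn n) i) x + f ord_max x).
  by apply: Ck_add => //; apply: IH.
by apply/funext => x; rewrite big_ord_recr.
Qed.

End Gen.

Lemma Ck_mul k U (f g : V -> R) : open U -> Ck k U f -> Ck k U g ->
  Ck k U (fun x => f x * g x).
Proof.
move=> oU; elim: k f g => [|k IH] f g hf hg.
  split=> // x Ux; apply: differentiableM; [exact: (Ck_diff hf)|exact: (Ck_diff hg)].
split; first by move=> x Ux; apply: differentiableM;
  [exact: (Ck_diff hf)|exact: (Ck_diff hg)].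
move=> v.
have h := Ck_add oU (IH _ _ (CkW hf) (hg.2 v)) (IH _ _ (CkW hg) (hf.2 v)).
apply: (Ck_eq oU _ h) => x Ux.
by rewrite -[RHS]/('D_v (f * g) x) deriveM//; apply: diff_derivable;
  [exact: (Ck_diff hf)|exact: (Ck_diff hg)].
Qed.

Section Row.
Variable n : nat.
Implicit Types (f : V -> 'rV[R]_n).

Lemma differentiable_rowP f x :
  differentiable f x <-> forall j, differentiable (fun y => f y 0 j : R) x.
Proof.
split=> [df j|df].
  by apply: (@differentiable_comp _ _ _ _ f (fun N : 'rV[R]_n => N 0 j : R) x df);
     exact: differentiable_coord.
rewrite (_ : f = \sum_(j < n) (fun y => f y 0 j *: delta_mx 0 j)).
  by apply: differentiable_sum => j; apply: differentiableZl.
by apply/funext => y; rewrite fct_sumE [LHS]row_sum_delta.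
Qed.

Lemma derive_row f x v j : differentiable f x ->
  ('D_v f x) 0 j = 'D_v (fun y => f y 0 j : R) x.
Proof. by move=> df; rewrite derive_mx ?mxE//; exact: diff_derivable. Qed.

Lemma Ck_rowP k U f : open U ->
  Ck k U f <-> forall j, Ck k U (fun y => f y 0 j : R).
Proof.
move=> oU; elim: k f => [|k IH] f; split.
- by move=> [df _] j; split=> // x /df/differentiable_rowP.
- by move=> df; split=> // x Ux; apply/differentiable_rowP => j; exact: (df j).1.
- move=> [df hf] j; split=> [x /df/differentiable_rowP//|v].
  apply: (Ck_eq oU _ ((IH _).1 (hf v) j)) => x Ux; apply: derive_row; exact: df.
- move=> hf; have df x : U x -> differentiable f x.
    by move=> Ux; apply/differentiable_rowP => j; exact: (hf j).1.
  split=> // v; apply/IH => j; apply: (Ck_eq oU _ ((hf j).2 v)) => x Ux.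
  by rewrite derive_row//; exact: df.
Qed.

Lemma smooth_on_rowP U f : open U ->
  smooth_on U f <-> forall j, smooth_on U (fun y => f y 0 j : R).
Proof.
move=> oU; split=> [/smooth_onP h j|h].
  by apply/smooth_onP => k; exact: ((Ck_rowP _ _ oU).1 (h k)).
by apply/smooth_onP => k; apply/(Ck_rowP _ _ oU) => j; exact: (smooth_onP _ _).1.
Qed.

End Row.
End Ck.

Section Dir.
Variables (R : realType) (m : nat).
Local Notation E := 'rV[R]_m.
Variable W : normedModType R.

Lemma derive_sum_delta (f : E -> W) x v : differentiable f x ->
  'D_v f x = \sum_j v 0 j *: 'D_(delta_mx 0 j) f x.
Proof.
move=> df; rewrite deriveE// {1}[v]row_sum_delta linear_sum.
by apply: eq_bigr => j _; rewrite linearZ deriveE.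
Qed.

Lemma derive_linear (f : E -> W) x a u v : differentiable f x ->
  'D_(a *: u + v) f x = a *: 'D_u f x + 'D_v f x.
Proof. by move=> df; rewrite !deriveE// linearP. Qed.

End Dir.

Section Comp.
Variables (R : realType) (V : normedModType R) (m : nat).
Local Notation E := 'rV[R]_m.

Lemma derive_comp (W : normedModType R) (g : V -> E) (f : E -> W) x v :
  differentiable g x -> differentiable f (g x) ->
  'D_v (f \o g) x = 'D_('D_v g x) f (g x).
Proof.
move=> dg df; rewrite !deriveE//; last exact: differentiable_comp.
by rewrite diff_comp.
Qed.

(** The chain rule, expanded over the basis of E, expresses a derivative of the
    composite by products of composites of the same kind, of order one less. *)
Lemma Ck_comp k (U : set V) (U' : set E) (g : V -> E) (f : E -> R) :
  open U -> (forall x, U x -> U' (g x)) ->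
  Ck k U' f -> Ck k U g -> Ck k U (f \o g).
Proof.
move=> oU UU; elim: k f => [|k IH] f [df hf] [dg hg]; split=> //;
  try by move=> x Ux; apply: differentiable_comp; [exact: dg|exact/df/UU].
move=> v.
have hs : Ck k U (fun x =>
    \sum_j ('D_v g x) 0 j * ('D_(delta_mx 0 j) f \o g) x).
  apply: Ck_sum => // j; apply: Ck_mul => //.
    exact: ((Ck_rowP _ _ oU).1 (hg v)).
  by apply: IH; [exact: hf|exact: (@CkW _ _ _ k U g (conj dg hg))].
apply: (Ck_eq oU _ hs) => x Ux; rewrite derive_comp ?derive_sum_delta//.
- exact/df/UU.
- exact: dg.
- exact/df/UU.
Qed.

Lemma smooth_on_comp (U : set V) (U' : set E) (g : V -> E) (f : E -> R) :
  open U -> (forall x, U x -> U' (g x)) ->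
  smooth_on U' f -> smooth_on U g -> smooth_on U (f \o g).
Proof.
move=> oU UU /smooth_onP hf /smooth_onP hg; apply/smooth_onP => k.
exact: Ck_comp UU _ _.
Qed.

Lemma smooth_on_comp_row n (U : set V) (U' : set E) (g : V -> E)
  (f : E -> 'rV[R]_n) :
  open U -> open U' -> (forall x, U x -> U' (g x)) ->
  smooth_on U' f -> smooth_on U g -> smooth_on U (f \o g).
Proof.
move=> oU oU' UU /smooth_on_rowP hf hg; apply/smooth_on_rowP => // j.
by apply: (@smooth_on_comp U U' g (fun y => f y 0 j)) => //; exact: hf.
Qed.

End Comp.

Section Smooth.
Variables (R : realType) (V W : normedModType R).
Implicit Types (f g : V -> W) (U : set V).

Lemma smooth_on_eq U f g : open U -> (forall x, U x -> f x = g x) ->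
  smooth_on U f -> smooth_on U g.
Proof.
by move=> oU e /smooth_onP h; apply/smooth_onP => k; exact: Ck_eq e (h k).
Qed.

Lemma smooth_on_sub U U' f : U' `<=` U -> smooth_on U f -> smooth_on U' f.
Proof.
by move=> UU /smooth_onP h; apply/smooth_onP => k; exact: Ck_sub UU (h k).
Qed.

Lemma smooth_on_cst U (w : W) : smooth_on U (cst w).
Proof. by apply/smooth_onP => k; exact: Ck_cst. Qed.

Lemma smooth_on_add U f g : open U -> smooth_on U f -> smooth_on U g ->
  smooth_on U (fun x => f x + g x).
Proof.
by move=> oU /smooth_onP hf /smooth_onP hg; apply/smooth_onP => k; exact: Ck_add.
Qed.

Lemma smooth_on_sum U n (f : 'I_n -> V -> W) : open U ->
  (forall i, smooth_on U (f i)) -> smooth_on U (fun x => \sum_i f i x).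
Proof.
move=> oU hf; apply/smooth_onP => k; apply: Ck_sum => // i.
exact: (smooth_onP _ _).1.
Qed.

Lemma smooth_on_mul U (f g : V -> R) : open U ->
  smooth_on U f -> smooth_on U g -> smooth_on U (fun x => f x * g x).
Proof.
by move=> oU /smooth_onP hf /smooth_onP hg; apply/smooth_onP => k; exact: Ck_mul.
Qed.

Lemma smooth_on_id U : smooth_on U (@id V).
Proof.
move=> s x Ux; elim/last_ind: s => [|s v _] /=.
  by apply: ex_diff; exact: is_diff_id.
rewrite foldr_rcons (_ : 'D_v id = cst v); last first.
  by apply/funext => y; exact: derive_id.
suff h : smooth_on U (cst v) by exact: h Ux.
by apply/smooth_onP => k; exact: Ck_cst.
Qed.

Lemma smooth_on_local U f :
  (forall x, U x -> exists2 U' : set V, U' x & smooth_on U' f) -> smooth_on U f.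
Proof. by move=> h s x /h[U' U'x]; exact. Qed.

End Smooth.

Section SmoothDir.
Variables (R : realType) (m : nat).
Local Notation E := 'rV[R]_m.

Lemma smooth_on_dir (U : set E) (Y : E -> E) (f : E -> R) : open U ->
  smooth_on U Y -> smooth_on U f -> smooth_on U (fun x => 'D_(Y x) f x).
Proof.
move=> oU hY hf.
apply: (@smooth_on_eq _ _ _ U (fun x =>
  \sum_j (Y x) 0 j * 'D_(delta_mx 0 j) f x)) => //.
  by move=> x Ux; rewrite [RHS]derive_sum_delta//; exact: smooth_on_diff Ux.
apply: smooth_on_sum => // j; apply: smooth_on_mul => //.
  exact: (smooth_on_rowP _ oU).1.
exact: smooth_on_derive.
Qed.

Lemma smooth_on_dir_row n (U : set E) (Y : E -> E) (f : E -> 'rV[R]_n) : open U ->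
  smooth_on U Y -> smooth_on U f -> smooth_on U (fun x => 'D_(Y x) f x).
Proof.
move=> oU hY hf; apply/smooth_on_rowP => // j.
apply: (@smooth_on_eq _ _ _ U (fun x => 'D_(Y x) (fun y => f y 0 j : R) x)) => //.
  by move=> x Ux; rewrite derive_row//; exact: smooth_on_diff Ux.
apply: smooth_on_dir => //; exact: (smooth_on_rowP _ oU).1.
Qed.

(** The second-order terms cancel by symmetry of second derivatives, so the
    commutator of two first-order operators has order one. *)
Lemma derive_dir_commutator (U : set E) (X Y : E -> E) (f : E -> R) x : open U ->
  U x -> smooth_on U X -> smooth_on U Y -> smooth_on U f ->
  'D_(X x) (fun y => 'D_(Y y) f y) x - 'D_(Y x) (fun y => 'D_(X y) f y) x
  = 'D_('D_(X x) Y x - 'D_(Y x) X x) f x.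
Proof.
move=> oU Ux hX hY hf.
have df v y : U y -> differentiable ('D_v f) y.
  by move=> Uy; apply: smooth_on_diff Uy; exact: smooth_on_derive.
have dfx y : U y -> differentiable f y by move=> Uy; exact: smooth_on_diff Uy.
have ndf : \forall y \near x, differentiable f y.
  by near=> y; apply: dfx; near: y; exact: (@open_near R E U x oU Ux).
(* Differentiating the direction Z gives the first term; freezing it at x, the second. *)
have key (Z : E -> E) v : smooth_on U Z ->
    'D_v (fun y => 'D_(Z y) f y) x = 'D_('D_v Z x) f x + 'D_v ('D_(Z x) f) x.
  move=> hZ; have dZ := smooth_on_diff hZ Ux.
  have e : \near x, 'D_(Z x) f x =
      (\sum_j (fun y => (Z y) 0 j : R) * 'D_(delta_mx 0 j) f) x.
    near=> y; rewrite fct_sumE derive_sum_delta//; apply: dfx.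
    by near: y; exact: (@open_near R E U x oU Ux).
  have dZj j : differentiable (fun y => (Z y) 0 j : R) x.
    by move/differentiable_rowP: dZ.
  rewrite (near_eq_derive _ e) derive_sum; last first.
    by move=> j; apply: derivableM; apply: diff_derivable => //; exact: df.
  rewrite (eq_bigr (fun j => (Z x) 0 j *: 'D_v ('D_(delta_mx 0 j) f) x
      + 'D_(delta_mx 0 j) f x *: 'D_v (fun y => (Z y) 0 j : R) x)); last first.
    by move=> j _; rewrite deriveM//; apply: diff_derivable => //; exact: df.
  rewrite big_split/= addrC; congr (_ + _).
    rewrite [RHS]derive_sum_delta//; last exact: dfx.
    by apply: eq_bigr => j _; rewrite derive_row// /GRing.scale/= mulrC.
  rewrite [RHS](derive_comm ndf (df _ _ Ux) (df _ _ Ux)).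
  rewrite [RHS](derive_sum_delta _ (df v x Ux)).
  apply: eq_bigr => j _.
  by rewrite (derive_comm ndf (df (delta_mx 0 j) _ Ux) (df v _ Ux)).
rewrite (key X _ hX) (key Y _ hY) opprD addrACA [X in _ + X](_ : _ = 0).
  rewrite addr0 -scaleN1r [in RHS]addrC -[in RHS]scaleN1r.
  by rewrite (derive_linear _ _ _ (dfx _ Ux)) addrC.
by rewrite (derive_comm ndf (df (X x) _ Ux) (df (Y x) _ Ux)) subrr.
Unshelve. all: by end_near. Qed.

End SmoothDir.

(** * Vectors and functions in charts *)

Section Charts.
Variables (R : realType) (m : nat) (M : smooth_manifold R m).
Local Notation E := 'rV[R]_m.
Implicit Types (i j k : Defs.index M) (p q : M) (U V : set M) (f g : M -> R).
Implicit Types (X Y Z : vfield M) (v w : E).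

Definition trans i j : E -> E := chart j \o chart_inv i.

Definition img i U : set E := chart i @` (U `&` dom i).

Lemma imgP i U x : img i U x <->
  (chart i @` dom i) x /\ U (chart_inv i x).
Proof.
split=> [[p [Up ip] <-]|[[p ip <-]]]; last by rewrite chartK// => Up; exists p.
by split; [exists p|rewrite chartK].
Qed.

Lemma img_mem i U p : U p -> dom i p -> img i U (chart i p).
Proof. by move=> Up ip; exists p. Qed.

Lemma open_img i U : open U -> open (img i U).
Proof.
move=> oU; rewrite openE => x /imgP[ix Ux].
have n1 : nbhs x (chart i @` dom i).
  by apply: open_nbhs_nbhs; split=> //; exact: image_open.
have n2 : nbhs x (chart_inv i @^-1` U).
  by apply: (chart_inv_continuous ix); apply: open_nbhs_nbhs.
by rewrite /interior; near=> y; apply/imgP; split; near: y.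
Unshelve. all: by end_near. Qed.

Arguments open_img i {U}.

Lemma near_chart i U p : open U -> U p -> dom i p ->
  \forall x \near chart i p, U (chart_inv i x) /\ dom i (chart_inv i x)
    /\ chart i (chart_inv i x) = x.
Proof.
move=> oU Up ip.
have : nbhs (chart i p) (img i U).
  by apply: open_nbhs_nbhs; split; [exact: open_img|exact: img_mem].
by apply: filterS => _ [q [Uq iq] <-]; rewrite chartK.
Qed.

Lemma trans_smooth i j : smooth_on (img i (dom j)) (trans i j).
Proof. by rewrite /img setIC; exact: transition_smooth. Qed.

Lemma trans_diff i j p : dom i p -> dom j p ->
  differentiable (trans i j) (chart i p).
Proof. by move=> ip jp; apply: (smooth_on_diff (@trans_smooth i j)); exists p. Qed.

Lemma transE i j p : dom i p -> trans i j (chart i p) = chart j p.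
Proof. by move=> ip; rewrite /trans/= chartK. Qed.

(** The change of components, from chart i to chart j, of a tangent vector at p. *)
Definition change i j p v : E := 'D_v (trans i j) (chart i p).

Lemma change_id i p v : dom i p -> change i i p v = v.
Proof.
move=> ip; rewrite /change -[RHS](derive_id (chart i p)); apply: near_eq_derive.
by have := near_chart openT I ip; apply: filterS => x [_ []].
Qed.

Lemma change_comp i j k p v : dom i p -> dom j p -> dom k p ->
  change j k p (change i j p v) = change i k p v.
Proof.
move=> ip jp kp.
rewrite /change -[X in derive _ X _](transE j ip).
have -> : 'D_v (trans i k) (chart i p) = 'D_v (trans j k \o trans i j) (chart i p).
  apply: near_eq_derive.
  have := near_chart (dom_open j) jp ip; apply: filterS => x [jx _] /=.
  by rewrite /trans/= chartK.
by rewrite derive_comp//; [exact: trans_diff|rewrite transE//; exact: trans_diff].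
Qed.

Lemma change_linear i j p a v w : dom i p -> dom j p ->
  change i j p (a *: v + w) = a *: change i j p v + change i j p w.
Proof. by move=> ip jp; apply: derive_linear; exact: trans_diff. Qed.

(** A tangent vector at p is stored by its components in the chart chosen at p,
    so that passing to chart i is a change of chart. *)
Definition to_chart i p v := change (chart_at p) i p v.
Definition from_chart i p v := change i (chart_at p) p v.

Lemma to_chartK i p v : dom i p -> from_chart i p (to_chart i p v) = v.
Proof.
move=> ip; rewrite /from_chart /to_chart change_comp ?change_id//; exact: chart_at_dom.
Qed.

Lemma from_chartK i p v : dom i p -> to_chart i p (from_chart i p v) = v.
Proof.
move=> ip; rewrite /from_chart /to_chart change_comp ?change_id//; exact: chart_at_dom.
Qed.

Lemma to_chart_linear i p a v w : dom i p ->
  to_chart i p (a *: v + w) = a *: to_chart i p v + to_chart i p w.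
Proof. by move=> ip; apply: change_linear => //; exact: chart_at_dom. Qed.

Lemma to_chart0 i p : dom i p -> to_chart i p 0 = 0.
Proof. by rewrite /to_chart /change => _; exact: derive0. Qed.

Lemma from_chart_linear i p a v w : dom i p ->
  from_chart i p (a *: v + w) = a *: from_chart i p v + from_chart i p w.
Proof. by move=> ip; apply: change_linear => //; exact: chart_at_dom. Qed.

Lemma coord_vfieldE i X p : dom i p ->
  coord_vfield i X (chart i p) = to_chart i p (X p).
Proof. by move=> ip; rewrite /coord_vfield chartK. Qed.

Lemma const_vfieldE p v q : const_vfield p v q = from_chart (chart_at p) q v.
Proof. by []. Qed.

Lemma const_vfield_id p v : const_vfield p v p = v.
Proof. by rewrite const_vfieldE /from_chart change_id//; exact: chart_at_dom. Qed.

Lemma to_chart_const p v q : dom (chart_at p) q ->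
  to_chart (chart_at p) q (const_vfield p v q) = v.
Proof. by move=> h; rewrite const_vfieldE from_chartK. Qed.

(** * Smoothness can be tested in one chart around each point *)

Lemma smooth_fun_chart U f :
  (forall p, U p -> exists i V, [/\ open V, V p, dom i p &
     smooth_on (img i V) (f \o chart_inv i)]) -> smooth_fun U f.
Proof.
move=> h j; apply: smooth_on_local => _ [p [Up jp] <-].
have [i [V [oV Vp ip sf]]] := h p Up.
have oS : open (img j (V `&` dom i)).
  by apply: open_img; apply: openI => //; exact: dom_open.
exists (img j (V `&` dom i)); first exact: img_mem.
apply: (@smooth_on_eq _ _ _ _ ((f \o chart_inv i) \o trans j i)) => //.
  by move=> _ [q [[Vq iq] jq] <-] /=; rewrite /trans/= !chartK.
apply: smooth_on_comp (sf) _ => //.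
  by move=> _ [q [[Vq iq] jq] <-]; rewrite transE//; exists q.
apply: smooth_on_sub (@trans_smooth j i) => _ [q [[Vq iq] jq] <-].
exact: img_mem.
Qed.

(** In another chart j the components are [change i j] applied to those in chart
    i, a derivative of the smooth transition in a smoothly varying direction. *)
Lemma smooth_vfield_chart U X :
  (forall p, U p -> exists i V, [/\ open V, V p, dom i p &
     smooth_on (img i V) (coord_vfield i X)]) -> smooth_vfield U X.
Proof.
move=> h j; apply: smooth_on_local => _ [p [Up jp] <-].
have [i [V [oV Vp ip sX]]] := h p Up.
have oW : open ((V `&` dom i) `&` dom j).
  by apply: openI; [apply: openI|] => //; exact: dom_open.
set W := (V `&` dom i) `&` dom j in oW.
have oS : open (img j W) by exact: open_img.
have oT : open (img i W) by exact: open_img.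
exists (img j W); first exact: img_mem.
pose F x := 'D_(coord_vfield i X x) (trans i j) x.
suff sF : smooth_on (img j W) (F \o trans j i).
  apply: (smooth_on_eq oS _ sF) => _ [q [[[Vq iq] _] jq] <-].
  rewrite /ssrfun.comp /F (transE i jq) (coord_vfieldE X iq) (coord_vfieldE X jq).
  exact: change_comp (chart_at_dom q) iq jq.
apply: (@smooth_on_comp_row _ _ _ _ _ (img i W)) => //.
- by move=> _ [q [Wq jq] <-]; rewrite transE//; apply: img_mem => //; case: Wq => [[]].
- apply: smooth_on_dir_row => //.
    by apply: smooth_on_sub (sX) => _ [q [[[Vq iq] _] _] <-]; exact: img_mem.
  by apply: smooth_on_sub (@trans_smooth i j) => _ [q [[[Vq iq] ?] _] <-]; exact: img_mem.
- by apply: smooth_on_sub (@trans_smooth j i) => _ [q [[[Vq iq] ?] _] <-]; exact: img_mem.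
Qed.

Lemma img_sub i U V : V `<=` U -> img i V `<=` img i U.
Proof. by move=> VU _ [q [Vq iq] <-]; apply: img_mem => //; exact: VU. Qed.

Lemma smooth_fun_sub U V f : V `<=` U -> smooth_fun U f -> smooth_fun V f.
Proof. by move=> VU h i; apply: smooth_on_sub (h i); exact: img_sub. Qed.

Lemma smooth_vfield_sub U V X : V `<=` U -> smooth_vfield U X -> smooth_vfield V X.
Proof. by move=> VU h i; apply: smooth_on_sub (h i); exact: img_sub. Qed.

Lemma smooth_fun_eq U f g : open U -> (forall p, U p -> f p = g p) ->
  smooth_fun U f -> smooth_fun U g.
Proof.
move=> oU e h i; apply: smooth_on_eq (h i); first exact: open_img.
by move=> _ [q [Uq iq] <-] /=; rewrite chartK// e.
Qed.

Lemma smooth_vfield_eq U X Y : open U -> (forall p, U p -> X p = Y p) ->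
  smooth_vfield U X -> smooth_vfield U Y.
Proof.
move=> oU e h i; apply: smooth_on_eq (h i); first exact: open_img.
move=> _ [q [Uq iq] <-].
by rewrite (coord_vfieldE X iq) (coord_vfieldE Y iq) (e q Uq).
Qed.

Lemma smooth_fun_cst U (a : R) : smooth_fun U (cst a).
Proof.
by move=> i s x; rewrite -[X in _ X s](_ : cst a = _)//; exact: smooth_on_cst.
Qed.

Lemma smooth_fun_mul U f g : open U -> smooth_fun U f -> smooth_fun U g ->
  smooth_fun U (fun p => f p * g p).
Proof. by move=> oU hf hg i; apply: smooth_on_mul; [exact: open_img|exact: hf|exact: hg]. Qed.

Lemma smooth_fun_sum U n (F : 'I_n -> M -> R) : open U ->
  (forall l, smooth_fun U (F l)) -> smooth_fun U (fun p => \sum_l F l p).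
Proof.
by move=> oU hF i; apply: smooth_on_sum => [|k]; [exact: open_img|exact: hF].
Qed.

Lemma smooth_vfield_comb U f X Y : open U -> smooth_fun U f ->
  smooth_vfield U X -> smooth_vfield U Y ->
  smooth_vfield U (fun p => f p *: X p + Y p).
Proof.
move=> oU hf hX hY i; have oI := open_img i oU; apply/smooth_on_rowP => // l.
have hXl := (smooth_on_rowP _ oI).1 (hX i) l.
have hYl := (smooth_on_rowP _ oI).1 (hY i) l.
apply: smooth_on_eq (smooth_on_add oI (smooth_on_mul oI (hf i) hXl) hYl) => //.
move=> _ [q [Uq iq] <-] /=.
by rewrite !coord_vfieldE// chartK// to_chart_linear// !mxE.
Qed.

Lemma smooth_vfield0 U : smooth_vfield U (fun=> 0).
Proof.
move=> i; apply: (@smooth_on_sub _ _ _ (img i setT)).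
  by apply: img_sub.
apply: (@smooth_on_eq _ _ _ _ (cst 0)); first exact: open_img openT.
  by move=> _ [q [_ iq] <-]; rewrite coord_vfieldE// to_chart0.
exact: smooth_on_cst.
Qed.

Lemma smooth_vfieldZ U f X : open U ->
  smooth_fun U f -> smooth_vfield U X -> smooth_vfield U (fun p => f p *: X p).
Proof.
move=> oU hf hX.
have h := smooth_vfield_comb oU hf hX (@smooth_vfield0 U).
apply: (smooth_vfield_eq oU _ h).
by move=> p _; rewrite addr0.
Qed.

Lemma smooth_vfieldB U X Y : open U ->
  smooth_vfield U X -> smooth_vfield U Y -> smooth_vfield U (fun p => X p - Y p).
Proof.
move=> oU hX hY.
have h := smooth_vfield_comb oU (@smooth_fun_cst U (-1)) hY hX.
apply: (smooth_vfield_eq oU _ h).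
by move=> p _; rewrite scaleN1r addrC.
Qed.

Lemma smooth_const_vfield p v : smooth_vfield (dom (chart_at p)) (const_vfield p v).
Proof.
apply: smooth_vfield_chart => q iq; exists (chart_at p), (dom (chart_at p)).
split=> //; first exact: dom_open.
apply: (@smooth_on_eq _ _ _ _ (cst v)); first exact/open_img/dom_open.
  by move=> _ [r [_ ir] <-]; rewrite coord_vfieldE// to_chart_const.
exact: smooth_on_cst.
Qed.

Definition component i l X q : R := to_chart i q (X q) 0 l.

Lemma smooth_component U i l X : open U -> smooth_vfield U X ->
  smooth_fun (U `&` dom i) (component i l X).
Proof.
move=> oU hX; have oI := open_img i oU.
apply: smooth_fun_chart => p [Up ip]; exists i, U; split=> //.
exact: ((smooth_on_rowP _ oI).1 (hX i) l).
Qed.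

Lemma vfield_expand p X q : dom (chart_at p) q ->
  X q = \sum_l component (chart_at p) l X q *: const_vfield p (delta_mx 0 l) q.
Proof.
move=> iq; rewrite -[LHS](to_chartK (X q) iq) [to_chart _ _ _]row_sum_delta.
have lin : linear (from_chart (chart_at p) q).
  by move=> a v w; rewrite from_chart_linear.
pose L : {linear E -> E} := HB.pack (from_chart (chart_at p) q)
  (GRing.isLinear.Build _ _ _ _ _ lin).
by rewrite -[from_chart _ _]/(L : E -> E) linear_sum; apply: eq_bigr => l _; rewrite linearZ.
Qed.

(** * Derivative of a function along a vector field *)

Lemma near_inv U f g i p : open U -> U p -> dom i p ->
  (forall q, U q -> f q = g q) ->
  \forall x \near chart i p, (f \o chart_inv i) x = (g \o chart_inv i) x.
Proof.
move=> oU Up ip e; have := near_chart oU Up ip.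
by apply: filterS => x [Ux _] /=; exact: e.
Qed.

Lemma der_eq U f g X p : open U -> U p -> (forall q, U q -> f q = g q) ->
  der X f p = der X g p.
Proof.
move=> oU Up e; apply: near_eq_derive; apply: (near_inv oU Up) => //.
exact: chart_at_dom.
Qed.

Lemma smooth_fun_diff U f i p : smooth_fun U f -> U p -> dom i p ->
  differentiable (f \o chart_inv i) (chart i p).
Proof. by move=> hf Up ip; apply: (smooth_on_diff (hf i)); exists p. Qed.

Lemma der_chart U f X i p : smooth_fun U f -> open U -> U p -> dom i p ->
  der X f p = 'D_(to_chart i p (X p)) (f \o chart_inv i) (chart i p).
Proof.
move=> hf oU Up ip; have cp := chart_at_dom p.
rewrite /der /to_chart /change -(transE i cp) -derive_comp; last 2 first.
  exact: trans_diff.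
  by rewrite transE//; exact: smooth_fun_diff hf Up ip.
apply: near_eq_derive; have := near_chart (dom_open i) ip cp.
by apply: filterS => x [ix _]; rewrite /trans/= chartK.
Qed.

Lemma smooth_der U f X : open U -> smooth_fun U f -> smooth_vfield U X ->
  smooth_fun U (der X f).
Proof.
move=> oU hf hX; apply: smooth_fun_chart => p Up.
exists (chart_at p), U; split=> //; first exact: chart_at_dom.
set i := chart_at p; have oI := open_img i oU.
apply: smooth_on_eq (smooth_on_dir oI (hX i) (hf i)) => //.
by move=> _ [q [Uq iq] <-] /=; rewrite chartK// coord_vfieldE// (der_chart X hf oU Uq iq).
Qed.

Section Der.
Variables (U : set M) (p : M).
Hypotheses (oU : open U) (Up : U p).

Lemma der_cst X (a : R) : der X (cst a) p = 0.
Proof. exact: derive_cst. Qed.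

Lemma derD X f g : smooth_fun U f -> smooth_fun U g ->
  der X (fun q => f q + g q) p = der X f p + der X g p.
Proof.
move=> hf hg; rewrite /der -deriveD//; apply: diff_derivable;
  [exact: smooth_fun_diff hf Up (chart_at_dom p)|
   exact: smooth_fun_diff hg Up (chart_at_dom p)].
Qed.

(** The bracket is defined at p by the components in a single chart, and there
    this is [derive_dir_commutator]. *)
Lemma der_bracket X Y f : smooth_fun U f -> smooth_vfield U X ->
  smooth_vfield U Y ->
  der X (der Y f) p - der Y (der X f) p = der (bracket X Y) f p.
Proof.
move=> hf hX hY; have cp := chart_at_dom p; set i := chart_at p in cp.
have oI := open_img i oU; have Ip := img_mem Up cp.
have cW W : coord_vfield i W (chart i p) = W p.
  by rewrite (coord_vfieldE W cp); exact: change_id.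
have e Z W : smooth_vfield U Z ->
    der W (der Z f) p = 'D_(W p)
      (fun x => 'D_(coord_vfield i Z x) (f \o chart_inv i) x) (chart i p).
  move=> hZ; apply: near_eq_derive; have := near_chart oU Up cp.
  apply: filterS => x [Ux [ix xK]]; rewrite -[in RHS]xK.
  by rewrite (coord_vfieldE Z ix) -(der_chart Z hf oU Ux ix).
rewrite (e Y X hY) (e X Y hX).
have := derive_dir_commutator oI Ip (hX i) (hY i) (hf i).
by rewrite !cW.
Qed.

End Der.

Lemma smooth_coordinate i l : smooth_fun (dom i) (fun q => chart i q 0 l).
Proof.
apply: smooth_fun_chart => q iq; exists i, (dom i); split=> //; first exact: dom_open.
have oI : open (img i (dom i)) by exact/open_img/dom_open.
apply: (@smooth_on_eq _ _ _ _ (fun x : E => x 0 l : R)) => //.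
  by move=> _ [r [_ ir] <-] /=; rewrite chartK.
by apply: (smooth_on_rowP id oI).1; exact: smooth_on_id.
Qed.

Lemma der_coordinate X i l p : dom i p ->
  der X (fun q => chart i q 0 l) p = component i l X p.
Proof.
move=> ip; have hc := @smooth_coordinate i l.
rewrite (der_chart X hc (dom_open i) ip ip) /component.
rewrite -[in RHS](derive_id (chart i p) (to_chart i p (X p))) derive_row//.
apply: near_eq_derive; have := near_chart (dom_open i) ip ip.
by apply: filterS => x [_ [_ e]] /=; rewrite e.
Qed.

(** At q the bracket is computed in the chart chosen at q, where the two fields
    need not be constant.  Its components in the chart of p are its derivatives of
    the coordinate functions, and the fields differentiate these to constants. *)
Lemma bracket_const p v w q : dom (chart_at p) q ->
  bracket (const_vfield p v) (const_vfield p w) q = 0.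
Proof.
move=> iq; set i := chart_at p in iq *; have oI := dom_open i.
set B := bracket _ _.
have B0 l : component i l B q = 0.
  rewrite -der_coordinate//.
  have hl := @smooth_coordinate i l.
  have hv u := @smooth_const_vfield p u.
  rewrite -(der_bracket oI iq hl (hv v) (hv w)).
  have e u r : dom i r -> der (const_vfield p u) (fun q => chart i q 0 l) r = cst (u 0 l) r.
    by move=> ir; rewrite der_coordinate// /component to_chart_const.
  have e0 := der_eq (const_vfield p v) oI iq (e w).
  have e1 := der_eq (const_vfield p w) oI iq (e v).
  rewrite [X in X - _]e0 [X in _ - X]e1.
  rewrite [X in X - _](der_cst q _ (w 0 l)).
  rewrite [X in _ - X](der_cst q _ (v 0 l)).
  by rewrite subrr.
rewrite -(to_chartK (B q) iq) (_ : to_chart i q (B q) = 0) ?/from_chart ?/change ?derive0//.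
by apply/rowP => l; rewrite [LHS]B0 mxE.
Qed.

Lemma bracketN X Y : bracket Y X = (fun q => - bracket X Y q).
Proof. by apply/funext => q; rewrite /bracket opprB. Qed.

Lemma der0 X f p : X p = 0 -> der X f p = 0.
Proof. by move=> e; rewrite /der e derive0. Qed.

End Charts.

(** * Operators linear over smooth functions *)

#[local] Opaque smooth_fun smooth_vfield smooth_on bracket der.

Section Tensorial.
Variables (R : realType) (m : nat) (M : smooth_manifold R m).
Local Notation E := 'rV[R]_m.
Implicit Types (X Y : vfield M).

(** Locality is asked for on all smaller neighbourhoods, because the frame in
    which a field is expanded exists only in a chart around p. *)
Definition tensorial (U0 : set M) (p : M) (T : vfield M -> E) :=
  (forall U X X', open U -> U p -> U `<=` U0 -> smooth_vfield U X ->
     (forall q, U q -> X q = X' q) -> T X = T X') /\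
  (forall U f X X', open U -> U p -> U `<=` U0 -> smooth_fun U f ->
     smooth_vfield U X -> smooth_vfield U X' ->
     T (fun q => f q *: X q + X' q) = f p *: T X + T X').

Lemma tensorial0 U0 p T : open U0 -> U0 p -> tensorial U0 p T -> T (fun=> 0) = 0.
Proof.
move=> oU Up [_ lin].
have := lin U0 (cst 1) (fun=> 0) (fun=> 0) oU Up (fun q h => h)
  (@smooth_fun_cst _ _ M U0 1) (@smooth_vfield0 _ _ M U0) (@smooth_vfield0 _ _ M U0).
rewrite (_ : (fun q => _) = fun=> 0); last first.
  by apply/funext => q; rewrite scaler0 addr0.
by rewrite scale1r => /eqP; rewrite -subr_eq0 opprD addNKr oppr_eq0 => /eqP.
Qed.

Lemma tensorial_sum U0 U p T (r : seq 'I_m) (f : 'I_m -> M -> R)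
    (X : 'I_m -> vfield M) : tensorial U0 p T -> open U -> U p -> U `<=` U0 ->
  (forall l, smooth_fun U (f l)) -> (forall l, smooth_vfield U (X l)) ->
  smooth_vfield U (fun q => \sum_(l <- r) f l q *: X l q) /\
  T (fun q => \sum_(l <- r) f l q *: X l q) = \sum_(l <- r) f l p *: T (X l).
Proof.
move=> tT oU Up UU hf hX.
have tU : tensorial U p T.
  by case: tT => t1 t2; split=> [V|V f' ] *; [apply: (t1 V)|apply: (t2 V)] => //;
    apply: subset_trans UU.
elim: r => [|l r [IHs IH]].
  rewrite big_nil (_ : (fun q => _) = fun=> 0); last first.
    by apply/funext => q; rewrite big_nil.
  by split; [exact: smooth_vfield0|exact: tensorial0 tU].
rewrite big_cons (_ : (fun q => _) = fun q =>
    f l q *: X l q + (\sum_(l <- r) f l q *: X l q)); last first.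
  by apply/funext => q; rewrite big_cons.
split; first exact: (smooth_vfield_comb oU (hf l) (hX l) IHs).
by rewrite (tU.2 U _ _ _ oU Up (fun q h => h) (hf l) (hX l) IHs) IH.
Qed.

(** Near p a field is a combination of coordinate fields whose coefficients are
    smooth functions, so that T X is the combination of the values of T at these
    fields with the coefficients taken at p. *)
Lemma tensorial_value U0 p T X Y : open U0 -> U0 p -> tensorial U0 p T ->
  smooth_vfield U0 X -> smooth_vfield U0 Y -> X p = Y p -> T X = T Y.
Proof.
move=> oU0 Up tT hX hY e; set i := chart_at p.
have ip : dom i p by exact: chart_at_dom.
pose U := U0 `&` dom i.
have oU : open U by apply: openI => //; exact: dom_open.
have UU : U `<=` U0 by move=> q [].
have Upp : U p by [].
suff key Z : smooth_vfield U0 Z -> T Z =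
    \sum_l component i l Z p *: T (const_vfield p (delta_mx 0 l)).
  by rewrite (key X hX) (key Y hY) /component e.
move=> hZ.
have hc l : smooth_vfield U (const_vfield p (delta_mx 0 l)).
  by apply: smooth_vfield_sub (@smooth_const_vfield _ _ M p _) => q [].
have hf l : smooth_fun U (component i l Z) by exact: smooth_component.
have [_ <-] := tensorial_sum (index_enum _) tT oU Upp UU hf hc.
apply: (tT.1 U _ _ oU Upp UU (smooth_vfield_sub UU hZ)).
by move=> q [_ iq]; exact: vfield_expand.
Qed.

(** Both sides are values of T at fields that agree at p. *)
Lemma tensorial_const_linear p T a v w : tensorial (dom (chart_at p)) p T ->
  T (const_vfield p (a *: v + w)) =
  a *: T (const_vfield p v) + T (const_vfield p w).
Proof.
move=> tT; have oU := dom_open (chart_at p); have Up := chart_at_dom p.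
have hv u := @smooth_const_vfield _ _ M p u.
have ha := @smooth_fun_cst _ _ M (dom (chart_at p)) a.
rewrite -[a in RHS]/(cst a p) -(tT.2 _ _ _ _ oU Up _ ha (hv v) (hv w))//.
apply: (tensorial_value oU Up tT) => //; first exact: smooth_vfield_comb.
by rewrite !const_vfield_id.
Qed.

End Tensorial.

(** * The curvature operator is linear over smooth functions *)

Section Connection.
Variables (R : realType) (m : nat) (M : smooth_manifold R m).
Local Notation E := 'rV[R]_m.
Variable D : connection M.
Implicit Types (X Y Z : vfield M) (U : set M) (p q : M) (f : M -> R).

Section At.
Variable U : set M.
Hypothesis oU : open U.

Lemma smooth_nabla X Y : smooth_vfield U X -> smooth_vfield U Y ->
  smooth_vfield U (D X Y).
Proof. exact: nabla_smooth. Qed.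

Lemma nablaDl X X' Y p : U p -> smooth_vfield U X -> smooth_vfield U X' ->
  smooth_vfield U Y -> D (fun q => X q + X' q) Y p = D X Y p + D X' Y p.
Proof.
move=> Up hX hX' hY.
have := nabla_linear D oU (@smooth_fun_cst _ _ M U 1) hX hX' hY Up.
rewrite /= scale1r => <-; congr (D _ _ _).
by apply/funext => q; rewrite scale1r.
Qed.

Lemma nabla0l Y p : U p -> smooth_vfield U Y -> D (fun=> 0) Y p = 0.
Proof.
move=> Up hY; have h0 := @smooth_vfield0 _ _ M U.
have := nablaDl Up h0 h0 hY.
rewrite (_ : (fun q => _) = fun=> 0); last by apply/funext => q; rewrite addr0.
by move/eqP; rewrite -subr_eq0 opprD addNKr oppr_eq0 => /eqP.
Qed.

Lemma nablaNl X Y p : U p -> smooth_vfield U X -> smooth_vfield U Y ->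
  D (fun q => - X q) Y p = - D X Y p.
Proof.
move=> Up hX hY.
have := nabla_linear D oU (@smooth_fun_cst _ _ M U (-1)) hX
  (@smooth_vfield0 _ _ M U) hY Up.
rewrite (nabla0l Up hY) addr0 scaleN1r => <-; congr (D _ _ _).
by apply/funext => q; rewrite scaleN1r addr0.
Qed.

Lemma nabla_combr f X Y Z p : U p -> smooth_fun U f -> smooth_vfield U X ->
  smooth_vfield U Y -> smooth_vfield U Z ->
  D X (fun q => f q *: Y q + Z q) p = der X f p *: Y p + f p *: D X Y p + D X Z p.
Proof.
move=> Up hf hX hY hZ.
by rewrite (nabla_additive D oU hX (smooth_vfieldZ oU hf hY) hZ Up)
  (nabla_leibniz D oU hf hX hY Up).
Qed.

Hypothesis tf : torsion_free D.

(** Absence of torsion replaces a computation in coordinates: the bracket is a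
    difference of covariant derivatives.  The same holds for locality below. *)
Lemma smooth_bracket X Y : smooth_vfield U X -> smooth_vfield U Y ->
  smooth_vfield U (bracket X Y).
Proof.
move=> hX hY; apply: (smooth_vfield_eq oU (tf oU hX hY)).
exact (smooth_vfieldB oU (smooth_nabla hX hY) (smooth_nabla hY hX)).
Qed.

Lemma smooth_curvature X Y Z : smooth_vfield U X -> smooth_vfield U Y ->
  smooth_vfield U Z -> smooth_vfield U (curvature_field D X Y Z).
Proof.
move=> hX hY hZ; have hB := smooth_bracket hX hY.
exact (smooth_vfieldB oU (smooth_vfieldB oU (smooth_nabla hX (smooth_nabla hY hZ))
  (smooth_nabla hY (smooth_nabla hX hZ))) (smooth_nabla hB hZ)).
Qed.

Lemma bracket_local X X' Y Y' q : smooth_vfield U X -> smooth_vfield U Y ->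
  (forall q, U q -> X q = X' q) -> (forall q, U q -> Y q = Y' q) ->
  U q -> bracket X Y q = bracket X' Y' q.
Proof.
move=> hX hY eX eY Uq.
have hX' := smooth_vfield_eq oU eX hX; have hY' := smooth_vfield_eq oU eY hY.
rewrite -(tf oU hX hY Uq) -(tf oU hX' hY' Uq) (nabla_local D oU hX hY eX eY Uq).
rewrite (nabla_local D oU hY hX eY eX Uq); reflexivity.
Qed.

Lemma curvature_local X X' Y Y' Z Z' p : U p ->
  smooth_vfield U X -> smooth_vfield U Y -> smooth_vfield U Z ->
  (forall q, U q -> X q = X' q) -> (forall q, U q -> Y q = Y' q) ->
  (forall q, U q -> Z q = Z' q) ->
  curvature_field D X Y Z p = curvature_field D X' Y' Z' p.
Proof.
move=> Up hX hY hZ eX eY eZ; rewrite /curvature_field.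
have hB := smooth_bracket hX hY.
have eB q := @bracket_local X X' Y Y' q hX hY eX eY.
have eXZ q := @nabla_local _ _ _ D U X X' Z Z' oU hX hZ eX eZ q.
have eYZ q := @nabla_local _ _ _ D U Y Y' Z Z' oU hY hZ eY eZ q.
have E1 := nabla_local D oU hX (smooth_nabla hY hZ) eX eYZ Up.
have E2 := nabla_local D oU hY (smooth_nabla hX hZ) eY eXZ Up.
have E3 := nabla_local D oU hB hZ eB eZ Up.
exact (f_equal2 (fun a b => a - b) (f_equal2 (fun a b => a - b) E1 E2) E3).
Qed.

Lemma curvature_fieldN X Y Z p : U p ->
  smooth_vfield U X -> smooth_vfield U Y -> smooth_vfield U Z ->
  curvature_field D Y X Z p = - curvature_field D X Y Z p.
Proof.
move=> Up hX hY hZ; rewrite /curvature_field.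
have := nablaNl Up (smooth_bracket hX hY) hZ; rewrite -bracketN.
move: (bracket X Y) (bracket Y X) => B B' ->.
by rewrite !opprD !opprK [D Y _ p + _]addrC.
Qed.

(** The derivative of f that comes from the second covariant derivative cancels
    the one that comes from the bracket. *)
Lemma curvature_field_linear1 f X X' Y Z p : U p -> smooth_fun U f ->
  smooth_vfield U X -> smooth_vfield U X' -> smooth_vfield U Y ->
  smooth_vfield U Z ->
  curvature_field D (fun q => f q *: X q + X' q) Y Z p =
  f p *: curvature_field D X Y Z p + curvature_field D X' Y Z p.
Proof.
move=> Up hf hX hX' hY hZ; rewrite /curvature_field.
have hB := smooth_bracket hX hY; have hB' := smooth_bracket hX' hY.
have hF := smooth_vfield_comb oU hf hX hX'.
have hC := smooth_vfield_comb oU hf hB hB'.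
have hBF := smooth_bracket hF hY.
pose g q := - der Y f q.
have hdf := smooth_der oU hf hY.
have hg : smooth_fun U g.
  apply: (smooth_fun_eq oU _ (smooth_fun_mul oU (@smooth_fun_cst _ _ M U (-1)) hdf)).
  by move=> q _; rewrite /g /= mulN1r.
have tX q (Uq : U q) := tf oU hX hY Uq.
have tX' q (Uq : U q) := tf oU hX' hY Uq.
have tF q (Uq : U q) := tf oU hF hY Uq.
move: (bracket X Y) (bracket X' Y) (bracket (fun q => f q *: X q + X' q) Y) hB hB' hBF hC tX tX' tF
  => B B' BF hB hB' hBF hC tX tX' tF.
have e2 q : U q -> BF q = g q *: X q + (f q *: B q + B' q).
  move=> Uq; rewrite -(tF q Uq) (nabla_linear D oU hf hX hX' hY Uq).
  rewrite (nabla_combr Uq hf hY hX hX') -(tX q Uq) -(tX' q Uq) /g.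
  by apply/rowP => j; rewrite !mxE; ring.
have e1 q := @nabla_linear _ _ _ D U f X X' Z oU hf hX hX' hZ q.
rewrite (nabla_linear D oU hf hX hX' (smooth_nabla hY hZ) Up).
rewrite (nabla_local D oU hY (smooth_nabla hF hZ) (fun q _ => erefl) e1 Up).
rewrite (nabla_combr Up hf hY (smooth_nabla hX hZ) (smooth_nabla hX' hZ)).
rewrite (nabla_local D oU hBF hZ e2 (fun q _ => erefl) Up).
rewrite (nabla_linear D oU hg hX hC hZ Up) (nabla_linear D oU hf hB hB' hZ Up).
by rewrite /g; apply/rowP => j; rewrite !mxE; ring.
Qed.

Lemma curvature_field_linear2 f X Y Y' Z p : U p -> smooth_fun U f ->
  smooth_vfield U X -> smooth_vfield U Y -> smooth_vfield U Y' ->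
  smooth_vfield U Z ->
  curvature_field D X (fun q => f q *: Y q + Y' q) Z p =
  f p *: curvature_field D X Y Z p + curvature_field D X Y' Z p.
Proof.
move=> Up hf hX hY hY' hZ; have hF := smooth_vfield_comb oU hf hY hY'.
rewrite (curvature_fieldN Up hF hX hZ) (curvature_fieldN Up hY hX hZ)
  (curvature_fieldN Up hY' hX hZ) (curvature_field_linear1 Up hf hY hY' hX hZ).
by rewrite opprD scalerN.
Qed.

(** The terms with second derivatives of f combine to [X (Y f) - Y (X f) - [X, Y] f],
    which vanishes by [der_bracket]. *)
Lemma curvature_field_linear3 f X Y Z Z' p : U p -> smooth_fun U f ->
  smooth_vfield U X -> smooth_vfield U Y -> smooth_vfield U Z ->
  smooth_vfield U Z' ->
  curvature_field D X Y (fun q => f q *: Z q + Z' q) p =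
  f p *: curvature_field D X Y Z p + curvature_field D X Y Z' p.
Proof.
move=> Up hf hX hY hZ hZ'; rewrite /curvature_field.
have hB := smooth_bracket hX hY.
have hF := smooth_vfield_comb oU hf hZ hZ'.
have key V W : smooth_vfield U V -> smooth_vfield U W ->
    D V (D W (fun q => f q *: Z q + Z' q)) p =
    der V (der W f) p *: Z p + der W f p *: D V Z p + der V f p *: D W Z p
    + f p *: D V (D W Z) p + D V (D W Z') p.
  move=> hV hW; have hdf := smooth_der oU hf hW.
  have e q : U q -> D W (fun q => f q *: Z q + Z' q) q =
      der W f q *: Z q + (f q *: D W Z q + D W Z' q).
    by move=> Uq; rewrite (nabla_combr Uq hf hW hZ hZ') addrA.
  have hWZ := smooth_nabla hW hZ; have hWZ' := smooth_nabla hW hZ'.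
  rewrite (nabla_local D oU hV (smooth_nabla hW hF) (fun q _ => erefl) e Up).
  rewrite (nabla_combr Up hdf hV hZ (smooth_vfield_comb oU hf hWZ hWZ')).
  by rewrite (nabla_combr Up hf hV hWZ hWZ') !addrA.
rewrite (key X Y hX hY) (key Y X hY hX).
have := der_bracket oU Up hf hX hY.
move: (bracket X Y) hB => B hB dB.
rewrite (nabla_combr Up hf hB hZ hZ') -dB.
move: (der X (der Y f) p) (der Y (der X f) p) (der X f p) (der Y f p) (f p) (Z p)
  (D X Z p) (D Y Z p) (D X (D Y Z) p) (D Y (D X Z) p) (D B Z p)
  (D X (D Y Z') p) (D Y (D X Z') p) (D B Z' p) => *.
by apply/rowP => j; rewrite !mxE; ring.
Qed.

End At.
End Connection.

(** * The curvature tensor and its symmetries *)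

#[local] Opaque curvature_field.

Lemma row_comb (R : realType) m (a : R) (v w : 'rV[R]_m) k :
  (a *: v + w) 0 k = a * v 0 k + w 0 k.
Proof. by rewrite !mxE. Qed.

Section Curvature.
Variables (R : realType) (m : nat) (M : smooth_manifold R m).
Local Notation E := 'rV[R]_m.
Variable D : connection M.
Hypothesis tf : torsion_free D.
Implicit Types (X Y Z : vfield M) (U : set M) (p q : M).
Implicit Types (x y z u : E).

Section At.
Variables (U0 : set M) (p : M).
Hypotheses (oU0 : open U0) (Up0 : U0 p).

Lemma tensorial_curvature1 Y Z : smooth_vfield U0 Y -> smooth_vfield U0 Z ->
  tensorial U0 p (fun X => curvature_field D X Y Z p).
Proof.
move=> hY hZ; split=> [U X X' oU Up UU hX e|U f X X' oU Up UU hf hX hX'];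
  have hYU := smooth_vfield_sub UU hY; have hZU := smooth_vfield_sub UU hZ.
- exact (curvature_local oU tf Up hX hYU hZU e (fun _ _ => erefl) (fun _ _ => erefl)).
- exact (curvature_field_linear1 oU tf Up hf hX hX' hYU hZU).
Qed.

Lemma tensorial_curvature2 X Z : smooth_vfield U0 X -> smooth_vfield U0 Z ->
  tensorial U0 p (fun Y => curvature_field D X Y Z p).
Proof.
move=> hX hZ; split=> [U Y Y' oU Up UU hY e|U f Y Y' oU Up UU hf hY hY'];
  have hXU := smooth_vfield_sub UU hX; have hZU := smooth_vfield_sub UU hZ.
- exact (curvature_local oU tf Up hXU hY hZU (fun _ _ => erefl) e (fun _ _ => erefl)).
- exact (curvature_field_linear2 oU tf Up hf hXU hY hY' hZU).
Qed.

Lemma tensorial_curvature3 X Y : smooth_vfield U0 X -> smooth_vfield U0 Y ->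
  tensorial U0 p (fun Z => curvature_field D X Y Z p).
Proof.
move=> hX hY; split=> [U Z Z' oU Up UU hZ e|U f Z Z' oU Up UU hf hZ hZ'];
  have hXU := smooth_vfield_sub UU hX; have hYU := smooth_vfield_sub UU hY.
- exact (curvature_local oU tf Up hXU hYU hZ (fun _ _ => erefl) (fun _ _ => erefl) e).
- exact (curvature_field_linear3 oU tf Up hf hXU hYU hZ hZ').
Qed.

End At.

(** Tensoriality in the three arguments: at every point, the operator agrees with
    the curvature tensor, which is defined from fields constant in one chart. *)
Lemma curvature_fieldE U p X Y Z : open U -> U p -> smooth_vfield U X ->
  smooth_vfield U Y -> smooth_vfield U Z ->
  curvature_field D X Y Z p = curvature D p (X p) (Y p) (Z p).
Proof.
move=> oU Up hX hY hZ; pose V := U `&` dom (chart_at p).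
have oV : open V by exact: (openI oU (dom_open _)).
have Vp : V p by split; [exact: Up|exact: chart_at_dom].
have VU : V `<=` U by move=> q [].
have Vi : V `<=` dom (chart_at p) by move=> q [].
have cX := smooth_vfield_sub Vi (@smooth_const_vfield _ _ M p (X p)).
have cY := smooth_vfield_sub Vi (@smooth_const_vfield _ _ M p (Y p)).
have cZ := smooth_vfield_sub Vi (@smooth_const_vfield _ _ M p (Z p)).
have {}hX := smooth_vfield_sub VU hX.
have {}hY := smooth_vfield_sub VU hY.
have {}hZ := smooth_vfield_sub VU hZ.
have t1 := tensorial_curvature1 p hY hZ.
have t2 := tensorial_curvature2 p cX hZ.
have t3 := tensorial_curvature3 p cX cY.
have e1 := tensorial_value oV Vp t1 hX cX (esym (const_vfield_id p (X p))).
have e2 := tensorial_value oV Vp t2 hY cY (esym (const_vfield_id p (Y p))).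
have e3 := tensorial_value oV Vp t3 hZ cZ (esym (const_vfield_id p (Z p))).
exact (etrans e1 (etrans e2 e3)).
Qed.

Let dp p := @dom_open _ _ M (chart_at p).
Let cp p := @chart_at_dom _ _ M p.
Let hc p v := @smooth_const_vfield _ _ M p v.

Lemma curvature_linear1 p a x x' y z :
  curvature D p (a *: x + x') y z = a *: curvature D p x y z + curvature D p x' y z.
Proof. exact (tensorial_const_linear a x x' (tensorial_curvature1 p (@hc p y) (@hc p z))). Qed.

Lemma curvature_linear2 p a x y y' z :
  curvature D p x (a *: y + y') z = a *: curvature D p x y z + curvature D p x y' z.
Proof. exact (tensorial_const_linear a y y' (tensorial_curvature2 p (@hc p x) (@hc p z))). Qed.

Lemma curvature_linear3 p a x y z z' :
  curvature D p x y (a *: z + z') = a *: curvature D p x y z + curvature D p x y z'.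
Proof. exact (tensorial_const_linear a z z' (tensorial_curvature3 p (@hc p x) (@hc p y))). Qed.

Lemma curvature_anti p x y z : curvature D p y x z = - curvature D p x y z.
Proof. exact (curvature_fieldN (dp p) tf (cp p) (@hc p x) (@hc p y) (@hc p z)). Qed.

(** Coordinate fields commute, so the last term of the curvature drops. *)
Lemma curvature_const p x y z :
  let X := const_vfield p x in let Y := const_vfield p y in
  let Z := const_vfield p z in
  curvature D p x y z = D X (D Y Z) p - D Y (D X Z) p.
Proof.
move=> X Y Z.
have b0 := nabla_local D (dp p) (smooth_bracket (dp p) tf (@hc p x) (@hc p y)) (@hc p z)
  (fun q iq => bracket_const x y iq) (fun q _ => erefl) (cp p).
rewrite (nabla0l D (dp p) (cp p) (@hc p z)) in b0.
rewrite -[RHS]subr0 -b0; reflexivity.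
Qed.

Lemma nabla_const_comm p x y q : dom (chart_at p) q ->
  D (const_vfield p x) (const_vfield p y) q = D (const_vfield p y) (const_vfield p x) q.
Proof.
move=> iq; have := tf (dp p) (@hc p x) (@hc p y) iq.
by rewrite (bracket_const x y iq) => /eqP; rewrite subr_eq0 => /eqP.
Qed.

(** For commuting fields absence of torsion makes [D X Y] symmetric, and the six
    second covariant derivatives cancel in pairs. *)
Lemma bianchi p x y z :
  curvature D p x y z + curvature D p y z x + curvature D p z x y = 0.
Proof.
rewrite !curvature_const.
have e u v w : D (const_vfield p u) (D (const_vfield p v) (const_vfield p w)) p
             = D (const_vfield p u) (D (const_vfield p w) (const_vfield p v)) p.
  apply: (nabla_local D (dp p) (@hc p u) (nabla_smooth D (dp p) (@hc p v) (@hc p w))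
    (fun _ _ => erefl) _ (cp p)) => q iq.
  exact (nabla_const_comm v w iq).
suff cyc (a b c a' b' c' : E) : b = b' -> c = c' -> a' = a ->
    a - b + (b' - c) + (c' - a') = 0 by exact (cyc _ _ _ _ _ _ (e y x z) (e z y x) (e x z y)).
by move=> <- <- ->; rewrite !addrA !subrK subrr.
Qed.

Section Form.
Variable Om : tensor2 M.
Hypothesis parOm : parallel D Om.

Lemma der_form U X Y Z p : open U -> U p -> smooth_vfield U X ->
  smooth_vfield U Y -> smooth_vfield U Z ->
  der X (fun q => Om q (Y q) (Z q)) p = Om p (D X Y p) (Z p) + Om p (Y p) (D X Z p).
Proof.
move=> oU Up hX hY hZ; have := parOm oU hX hY hZ Up.
by move/eqP; rewrite -addrA -opprD subr_eq0 => /eqP.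
Qed.

(** Commuting fields X and Y commute as derivations of the function Om(Z, W).
    Expanding both orders by parallelism leaves, after the mixed terms cancel,
    Om(R(X, Y) Z, W) + Om(Z, R(X, Y) W) = 0. *)
Lemma curvature_skew p x y z u :
  Om p (curvature D p x y z) u = - Om p z (curvature D p x y u).
Proof.
pose X := const_vfield p x; pose Y := const_vfield p y.
pose Z := const_vfield p z; pose W := const_vfield p u.
pose h q : R := Om q (Z q) (W q).
have oU := dp p; have Up := cp p.
have hX : smooth_vfield _ X := @hc p x; have hY : smooth_vfield _ Y := @hc p y.
have hZ : smooth_vfield _ Z := @hc p z; have hW : smooth_vfield _ W := @hc p u.
have hh : smooth_fun (dom (chart_at p)) h := tensor2_smooth Om oU hZ hW.
have key A B : smooth_vfield (dom (chart_at p)) A ->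
    smooth_vfield (dom (chart_at p)) B ->
    der A (der B h) p = Om p (D A (D B Z) p) (W p) + Om p (D B Z p) (D A W p)
      + (Om p (D A Z p) (D B W p) + Om p (Z p) (D A (D B W) p)).
  move=> hA hB; have hBZ := nabla_smooth D oU hB hZ; have hBW := nabla_smooth D oU hB hW.
  rewrite (der_eq A oU Up (fun q Uq => der_form oU Uq hB hZ hW)).
  rewrite (derD Up A (tensor2_smooth Om oU hBZ hW) (tensor2_smooth Om oU hZ hBW)).
  by rewrite (der_form oU Up hA hBZ hW) (der_form oU Up hA hZ hBW).
suff alg (d1 d2 d0 : R) (a b c d e f g k z' w' : E) : d1 - d2 = d0 -> d0 = 0 ->
    d1 = Om p a w' + Om p f g + (Om p e k + Om p z' c) ->
    d2 = Om p b w' + Om p e k + (Om p f g + Om p z' d) ->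
    z' = z -> w' = u -> Om p (a - b) u = - Om p z (c - d).
  rewrite (curvature_const p x y z) (curvature_const p x y u).
  exact (alg _ _ _ _ _ _ _ _ _ _ _ _ _ (der_bracket oU Up hh hX hY)
    (der0 h (bracket_const x y Up)) (key X Y hX hY) (key Y X hY hX)
    (const_vfield_id p z) (const_vfield_id p u)).
move=> <- dd e1 e2 <- <-; move: dd; rewrite e1 e2 linearBl linearBr.
move: (Om p a w') (Om p b w') (Om p z' c) (Om p z' d) (Om p f g) (Om p e k) => *.
lra.
Qed.

End Form.

Lemma ricci_linear1 p a x x' y :
  ricci D p (a *: x + x') y = a * ricci D p x y + ricci D p x' y.
Proof.
rewrite /ricci mulr_sumr -big_split; apply: eq_bigr => k _.
rewrite (curvature_linear2 p a); exact (row_comb _ _ _ _).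
Qed.

Lemma ricci_linear2 p a x y y' :
  ricci D p x (a *: y + y') = a * ricci D p x y + ricci D p x y'.
Proof.
rewrite /ricci mulr_sumr -big_split; apply: eq_bigr => k _.
rewrite (curvature_linear3 p a); exact (row_comb _ _ _ _).
Qed.

End Curvature.

(** * The Ricci tensor is smooth *)

(** The Ricci curvature at q is a trace in the chart chosen at q, which does not
    vary smoothly with q; this moves the trace to a chart fixed near a point. *)
Lemma trace_conj (R : realType) m (F C C' : 'rV[R]_m -> 'rV[R]_m) :
  linear F -> linear C -> linear C' -> cancel C' C -> cancel C C' ->
  \sum_l C (F (C' (delta_mx 0 l))) 0 l = \sum_l F (delta_mx 0 l) 0 l.
Proof.
move=> lF lC lC' K K'.
pose LF : {linear 'rV[R]_m -> 'rV[R]_m} := HB.pack F (GRing.isLinear.Build _ _ _ _ _ lF).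
pose LC : {linear 'rV[R]_m -> 'rV[R]_m} := HB.pack C (GRing.isLinear.Build _ _ _ _ _ lC).
pose LC' : {linear 'rV[R]_m -> 'rV[R]_m} := HB.pack C' (GRing.isLinear.Build _ _ _ _ _ lC').
pose A := lin1_mx LF; pose B := lin1_mx LC; pose B' := lin1_mx LC'.
have eF v : F v = v *m A by rewrite mul_rV_lin1.
have eC v : C v = v *m B by rewrite mul_rV_lin1.
have eC' v : C' v = v *m B' by rewrite mul_rV_lin1.
have BB : B *m B' = 1%:M.
  by apply/row_matrixP => l; rewrite !rowE mulmx1 mulmxA -eC -eC' K'.
transitivity (\tr (B' *m A *m B)).
  apply: eq_bigr => l _; rewrite eC' eF eC -!mulmxA -rowE mxE; reflexivity.
rewrite mxtrace_mulC mulmxA BB mul1mx.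
by apply: eq_bigr => l _; rewrite eF -rowE [RHS]mxE.
Qed.

Section RicciTensor.
Variables (R : realType) (m : nat) (M : smooth_manifold R m).
Local Notation E := 'rV[R]_m.
Variable D : connection M.
Hypothesis tf : torsion_free D.

(** In a fixed chart the trace is a sum of components of curvature fields of
    smooth vector fields. *)
Lemma smooth_ricci (U : set M) (X Y : vfield M) : open U ->
  smooth_vfield U X -> smooth_vfield U Y ->
  smooth_fun U (fun p => ricci D p (X p) (Y p)).
Proof.
move=> oU hX hY; apply: smooth_fun_chart => p Up; set i := chart_at p.
have ip : dom i p by exact: chart_at_dom.
pose V := U `&` dom i.
have oV : open V by exact: (openI oU (dom_open _)).
exists i, V; split; [exact: oV|by split|exact: ip|].
have VU : V `<=` U by move=> q [].
have Vi : V `<=` dom i by move=> q [].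
have {}hX := smooth_vfield_sub VU hX.
have {}hY := smooth_vfield_sub VU hY.
pose F l q := component i l (curvature_field D (const_vfield p (delta_mx 0 l)) X Y) q.
have hc l : smooth_vfield V (const_vfield p (delta_mx 0 l)).
  exact (smooth_vfield_sub Vi (@smooth_const_vfield _ _ M p (delta_mx 0 l))).
have hF l : smooth_fun V (F l).
  have := @smooth_component _ _ M V i l _ oV (smooth_curvature oV tf (hc l) hX hY).
  by apply: smooth_fun_sub => q Vq; split; [|exact: Vi].
have hS : smooth_fun V (fun q => \sum_l F l q) := smooth_fun_sum oV hF.
suff e q : V q -> \sum_l F l q = ricci D q (X q) (Y q).
  exact (@smooth_fun_eq _ _ M V _ _ oV e hS i).
move=> Vq; have iq := Vi q Vq.
rewrite /ricci -[RHS](@trace_conj _ _ (fun x => curvature D q x (X q) (Y q))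
  (to_chart i q) (from_chart i q)).
- apply: eq_bigr => l _; rewrite /F /component.
  by rewrite (curvature_fieldE tf oV Vq (hc l) hX hY).
- by move=> a v w; rewrite curvature_linear1.
- by move=> a v w; rewrite to_chart_linear.
- by move=> a v w; rewrite from_chart_linear.
- by move=> v; rewrite from_chartK.
- by move=> v; rewrite to_chartK.
Qed.

Definition scaled_ricci (c : R) (p : M) (x y : E) : R := c * ricci D p x y.

Lemma scaled_ricci_bilinear c p : bilinear_for
  (GRing.Scale.Law.clone _ _ *%R _) (GRing.Scale.Law.clone _ _ *%R _)
  (scaled_ricci c p).
Proof.
split=> [y|x] a v w; rewrite /scaled_ricci /=.
  by rewrite (ricci_linear1 tf); move: (ricci D p v y) (ricci D p w y) => *; ring.
by rewrite (ricci_linear2 tf); move: (ricci D p x v) (ricci D p x w) => *; ring.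
Qed.

Definition scaled_ricci_form (c : R) (p : M) : {biscalar E} :=
  HB.pack (scaled_ricci c p)
    (bilinear_isBilinear.Build R E E R _ _ _ (scaled_ricci_bilinear c p)).

Lemma scaled_ricci_smooth c (U : set M) (X Y : vfield M) : open U ->
  smooth_vfield U X -> smooth_vfield U Y ->
  smooth_fun U (fun p => scaled_ricci_form c p (X p) (Y p)).
Proof.
move=> oU hX hY.
exact (smooth_fun_mul oU (@smooth_fun_cst _ _ M U c) (smooth_ricci oU hX hY)).
Qed.

Definition ricci_tensor c := Tensor2 (scaled_ricci_smooth c).

Lemma ricci_tensorE c p x y : ricci_tensor c p x y = c * ricci D p x y.
Proof. reflexivity. Qed.

End RicciTensor.

(** * Linear algebra of symplectic curvature tensors *)

Section SymplecticAlgebra.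
Variables (R : realFieldType) (m : nat).
Local Notation E := 'rV[R]_m.
Variable om : {biscalar E}.
Hypothesis omxx : forall x, om x x = 0.
Hypothesis om_nondeg : forall x, (forall y, om x y = 0) -> x = 0.
Implicit Types (x y z u v w : E).

Lemma form_linear1 (b : {biscalar E}) s x y z :
  b (s *: x + y) z = s * b x z + b y z.
Proof. by rewrite linearDl linearZl_LR. Qed.

Lemma form_linear2 (b : {biscalar E}) s x y z :
  b z (s *: x + y) = s * b z x + b z y.
Proof. by rewrite linearDr linearZr_LR. Qed.

Lemma om_anti x y : om y x = - om x y.
Proof.
have := omxx (x + y); rewrite linearDl !linearDr /= !omxx add0r addr0.
by move/eqP; rewrite addrC addr_eq0 => /eqP.
Qed.

Lemma om_inj v w : (forall u, om v u = om w u) -> v = w.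
Proof.
by move=> e; apply/subr0_eq/om_nondeg => u; rewrite linearBl e subrr.
Qed.

Definition gram (b : {biscalar E}) : 'M[R]_m :=
  \matrix_(i, j) b (delta_mx 0 i) (delta_mx 0 j).

Lemma gramE (b : {biscalar E}) v u : b v u = (v *m gram b *m u^T) 0 0.
Proof.
rewrite mxE [in LHS](row_sum_delta u) linear_sumr; apply: eq_bigr => j _.
rewrite linearZr_LR /= !mxE mulrC; congr (_ * _).
rewrite [in LHS](row_sum_delta v) linear_sumlz; apply: eq_bigr => i _.
by rewrite linearZl_LR /= !mxE.
Qed.

Lemma gram_unit : gram om \in unitmx.
Proof.
rewrite -row_free_unit -kermx_eq0; apply/eqP/eqP/rowV0P => v /sub_kermxP vG.
by apply: om_nondeg => u; rewrite gramE vG mul0mx mxE.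
Qed.

(** Raising an index with the symplectic form. *)
Definition raise (b : {biscalar E}) v : E := v *m gram b *m invmx (gram om).

Lemma raiseE b v u : om (raise b v) u = b v u.
Proof. by rewrite gramE /raise mulmxKV ?gram_unit// -gramE. Qed.

Lemma raise_linear b : linear (raise b).
Proof. by move=> a v w; rewrite /raise !mulmxDl !scalemxAl. Qed.

Definition trace_fun (F : E -> E) : R := \sum_k F (delta_mx 0 k) 0 k.

Lemma trace_rank1 (phi : {scalar E}) w : trace_fun (fun x => phi x *: w) = phi w.
Proof.
rewrite /trace_fun [in RHS](row_sum_delta w) linear_sum; apply: eq_bigr => k _.
by rewrite mxE linearZ mulrC.
Qed.

Lemma trace_homothety a : trace_fun (fun x => a *: x) = m%:R * a.
Proof.
rewrite /trace_fun (eq_bigr (fun=> a)) => [|k _]; last by rewrite !mxE !eqxx mulr1.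
by rewrite sumr_const card_ord mulr_natl.
Qed.

(** An endomorphism in the symplectic Lie algebra is conjugate to minus its
    transpose. *)
Lemma trace_skew (F : E -> E) : linear F ->
  (forall v u, om (F v) u = - om v (F u)) -> trace_fun F = 0.
Proof.
move=> lF sk.
pose L : {linear E -> E} := HB.pack F (GRing.isLinear.Build _ _ _ _ _ lF).
pose A := lin1_mx L.
have FE v : F v = v *m A by rewrite mul_rV_lin1.
have trE : trace_fun F = \tr A.
  by apply: eq_bigr => k _; rewrite FE -rowE mxE.
have GA : A *m gram om = - (gram om *m A^T).
  have ent (B : 'M[R]_m) i j : B i j =
      ((delta_mx 0 i : E) *m B *m (delta_mx 0 j : E)^T) 0 0.
    by rewrite trmx_delta -rowE -colE !mxE.
  apply/matrixP => i j; have := sk (delta_mx 0 i) (delta_mx 0 j).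
  rewrite !gramE !FE trmx_mul => e.
  by rewrite [RHS]mxE !ent !mulmxA; move: e; rewrite !mulmxA.
have : \tr A = - \tr A.
  have e : A = - (gram om *m A^T) *m invmx (gram om).
    by rewrite -GA mulmxK ?gram_unit.
  rewrite {1}e mulNmx linearN /= mxtrace_mulC mulKmx ?gram_unit//.
  by rewrite mxtrace_tr.
by rewrite trE; move=> h; lra.
Qed.

Section Curv.
Variable rm : E -> E -> E -> E.
Hypothesis rm1 : forall a x x' y z,
  rm (a *: x + x') y z = a *: rm x y z + rm x' y z.
Hypothesis rm3 : forall a x y z z',
  rm x y (a *: z + z') = a *: rm x y z + rm x y z'.
Hypothesis rm_anti : forall x y z, rm y x z = - rm x y z.
Hypothesis rm_bianchi : forall x y z, rm x y z + rm y z x + rm z x y = 0.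
Hypothesis rm_skew : forall x y z u, om (rm x y z) u = - om z (rm x y u).

Definition curv4 x y z u := om (rm x y z) u.
Definition ric x y := trace_fun (fun e => rm e x y).

Lemma curv4_linear1 a x x' y z u : curv4 (a *: x + x') y z u = a * curv4 x y z u + curv4 x' y z u.
Proof. by rewrite /curv4 rm1 form_linear1. Qed.

Lemma curv4_anti x y z u : curv4 y x z u = - curv4 x y z u.
Proof. by rewrite /curv4 rm_anti linearNl. Qed.

Lemma curv4_linear2 a x y y' z u : curv4 x (a *: y + y') z u = a * curv4 x y z u + curv4 x y' z u.
Proof. by rewrite 3!(curv4_anti _ x) curv4_linear1; ring. Qed.

Lemma curv4_linear3 a x y z z' u : curv4 x y (a *: z + z') u = a * curv4 x y z u + curv4 x y z' u.
Proof. by rewrite /curv4 rm3 form_linear1. Qed.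

Lemma curv4_linear4 a x y z u u' : curv4 x y z (a *: u + u') = a * curv4 x y z u + curv4 x y z u'.
Proof. by rewrite /curv4 form_linear2. Qed.

Lemma curv4_sym x y z u : curv4 x y z u = curv4 x y u z.
Proof. by rewrite /curv4 rm_skew om_anti opprK. Qed.

Lemma curv4_bianchi x y z u : curv4 x y z u + curv4 y z x u + curv4 z x y u = 0.
Proof. by rewrite /curv4 -!linearDl rm_bianchi linear0l. Qed.

(** By the Bianchi identity the skew part of the Ricci tensor is, up to sign, the
    trace of [rm x y], an element of the symplectic Lie algebra. *)
Lemma ric_sym x y : ric x y = ric y x.
Proof.
have lin : linear (rm x y) by move=> a z z'; exact: rm3.
apply/subr0_eq; rewrite -[RHS]oppr0 -(trace_skew lin (rm_skew x y)) /ric /trace_fun.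
rewrite -sumrB -sumrN; apply: eq_bigr => k _; set e := delta_mx 0 k.
have := rm_bianchi e x y; rewrite (rm_anti e y) => h.
have {h} -> : rm x y e = rm e y x - rm e x y.
  by apply/subr0_eq; rewrite -[RHS]h opprB addrCA addrA addrAC.
by rewrite !mxE opprB.
Qed.

Section FromSectional.
Variable a : {biscalar E}.
Hypothesis a_sym : forall x y, a x y = a y x.
Hypothesis curv4_diag_sympl : forall x y, om x y != 0 -> curv4 x y x x = 4 * om x y * a x x.

(** For fixed x both sides are linear in y, and the vectors y that are not
    orthogonal to x span the space when x is nonzero. *)
Lemma curv4_diag x y : curv4 x y x x = 4 * om x y * a x x.
Proof.
have [xy|/curv4_diag_sympl//] := eqVneq (om x y) 0.
have [->|x0] := eqVneq x 0.
  by rewrite linear0l; have := curv4_linear1 0 0 0 y 0 0; rewrite scale0r add0r => h; lra.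
have [y0 xy0] : exists y0, om x y0 != 0.
  apply: contrapT => h; case/eqP: x0; apply: om_nondeg => z.
  by apply/eqP/negPn/negP => xz; apply: h; exists z.
have := curv4_diag_sympl (x := x) (y := 1 *: y + y0); rewrite curv4_linear2 linearDr linearZr_LR /= xy.
rewrite mulr0 add0r => /(_ xy0); rewrite (curv4_diag_sympl xy0) => h; lra.
Qed.

(** Polarizing [curv4_diag] gives the sum P of curv4 over the cyclic permutations
    of its first, third and fourth arguments.  By the Bianchi identity,
    exchanging the first two arguments changes P by 4 times curv4. *)
Lemma curv4_formula x y z u : curv4 x y z u = 2 * om x y * a z u + om z y * a x u
  + om u y * a x z + om x z * a y u + om x u * a y z.
Proof.
have P (v b c d : E) : curv4 b v c d + curv4 c v b d + curv4 d v b c =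
    4 * (om b v * a c d + om c v * a b d + om d v * a b c).
  have e (s t : R) : curv4 (s *: b + (t *: c + d)) v (s *: b + (t *: c + d)) (s *: b + (t *: c + d))
      = 4 * om (s *: b + (t *: c + d)) v
        * a (s *: b + (t *: c + d)) (s *: b + (t *: c + d)) by exact: curv4_diag.
  (* The four sign patterns isolate the coefficient of the product of b, c and d. *)
  have e1 := e 1 1; have e2 := e (-1) 1; have e3 := e 1 (-1); have e4 := e (-1) (-1).
  move: e1 e2 e3 e4.
  rewrite !(curv4_linear1, curv4_linear3, curv4_linear4, form_linear1, form_linear2).
  rewrite (curv4_sym b v c b) (curv4_sym b v d b) (curv4_sym b v d c) (curv4_sym c v c b)
    (curv4_sym c v d b) (curv4_sym c v d c) (curv4_sym d v c b) (curv4_sym d v d b) (curv4_sym d v d c).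
  rewrite (a_sym c b) (a_sym d b) (a_sym d c) => e1 e2 e3 e4.
  lra.
have p1 := P y x z u; have p2 := P x y z u.
have b1 := curv4_bianchi x y z u; have b2 := curv4_bianchi x y u z.
rewrite (om_anti x y) (om_anti x z) (om_anti x u) in p2.
have s1 := curv4_anti z y x u; have s2 := curv4_anti u y x z.
have s3 := curv4_anti x z y u; have s4 := curv4_anti x u y z.
have s5 := curv4_anti x y z u; have s6 := curv4_sym x y u z.
lra.
Qed.

(** In the trace of [curv4_formula] over its first argument the endomorphism of a
    itself contributes zero, since it is skew for om; the term that is a multiple
    of the identity contributes m times [a x y]. *)
Lemma ric_formula x y : ric x y = (m + 2)%:R * a x y.
Proof.
have skew v u : om (raise a v) u = - om v (raise a u).
  by rewrite raiseE a_sym -raiseE om_anti.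
have t0 := trace_skew (raise_linear a) skew.
have rmE e : rm e x y = (2 * om e x) *: raise a y + om y x *: raise a e
    - a e y *: x + om e y *: raise a x + a x y *: e.
  apply: om_inj => u; have := curv4_formula e x y u; rewrite /curv4 => ->.
  rewrite !(linearDl om) (linearNl om) !(linearZl_LR om) /= !raiseE (om_anti x u); ring.
have -> : ric x y = 2 * om (raise a y) x + om y x * trace_fun (raise a) - a x y
    + om (raise a x) y + m%:R * a x y.
  rewrite -(trace_homothety (a x y)) -[om (raise a y) x](trace_rank1 (applyr om x)).
  rewrite -[om (raise a x) y](trace_rank1 (applyr om y)).
  rewrite -[a x y in X in X + _ + _](trace_rank1 (applyr a y) x).
  rewrite /ric /trace_fun !mulr_sumr -sumrN -!big_split /=.
  by apply: eq_bigr => k _; rewrite rmE !mxE; ring.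
by rewrite t0 !raiseE (a_sym y x) natrD; ring.
Qed.

End FromSectional.
End Curv.
End SymplecticAlgebra.

(** * Symplectic planes *)

Section Planes.
Variables (R : realType) (m : nat).
Local Notation E := 'rV[R]_m.

Lemma plane_basis (L : {vspace E}) : \dim L = 2%N ->
  [/\ (vbasis L)`_0 \in L, (vbasis L)`_1 \in L, (vbasis L)`_0 != 0 &
   forall v, v \in L ->
     exists a b, v = a *: (vbasis L)`_0 + b *: (vbasis L)`_1].
Proof.
move=> dL; have bL := vbasisP L.
have fL := basis_free bL; have sL := span_basis bL.
have : size (vbasis L) = 2%N by rewrite size_tuple.
case: (tval (vbasis L)) fL sL => [|x [|y [|]]]//= fL sL _.
have xy v : v \in L -> exists a b, v = a *: x + b *: y.
  rewrite -sL span_cons span_seq1 => /memv_addP[_ /vlineP[a ->]] [_ /vlineP[b ->]] ->.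
  by exists a, b.
split=> //.
- by rewrite -sL memv_span// mem_head.
- by rewrite -sL memv_span// !inE eqxx orbT.
- by move: fL; apply: contraTN => /eqP ->; rewrite free_cons mem0v.
Qed.

Variable om : {biscalar E}.
Hypothesis omxx : forall x, om x x = 0.

Lemma alternating_comb (k : E -> E -> R) x y a b c d :
  (forall s u u' v, k (s *: u + u') v = s * k u v + k u' v) ->
  (forall u v, k v u = - k u v) ->
  k (a *: x + b *: y) (c *: x + d *: y) = (a * d - b * c) * k x y.
Proof.
move=> lin1 anti.
have kuu u : k u u = 0 by have := anti u u => h; lra.
have k0 v : k 0 v = 0.
  by have := lin1 1 0 0 v; rewrite scale1r addr0 => h; lra.
have lz s u v : k (s *: u) v = s * k u v.
  by rewrite -[s *: u]addr0 lin1 k0 addr0.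
rewrite lin1 lz (anti _ x) (anti _ y) !lin1 !lz !kuu (anti x y); ring.
Qed.

Lemma om_comb x y a b c d : om (a *: x + b *: y) (c *: x + d *: y) =
  (a * d - b * c) * om x y.
Proof.
apply: alternating_comb => [s u u' v|u v]; first by rewrite linearDl linearZl_LR.
exact: om_anti.
Qed.

Lemma span_plane x y : om x y != 0 ->
  let L := <<[:: x; y]>>%VS in
  [/\ \dim L = 2%N, x \in L, y \in L &
   forall v, v \in L -> (forall w, w \in L -> om v w = 0) -> v = 0].
Proof.
move=> xy L.
have y0 : y != 0 by apply: contra_neq xy => ->; rewrite linear0r.
have fr : free [:: x; y].
  rewrite free_cons seq1_free y0 andbT span_seq1; apply/vlineP => -[k e].
  by move: xy; rewrite e linearZl_LR /= omxx mulr0 eqxx.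
have xL : x \in L by rewrite memv_span// mem_head.
have yL : y \in L by rewrite memv_span// !inE eqxx orbT.
split=> //; first by apply/eqP; exact: fr.
move=> v vL h; have := h _ xL; have := h _ yL; move: vL {h}.
rewrite /L span_cons span_seq1 => /memv_addP[_ /vlineP[a ->]] [_ /vlineP[b ->]] ->.
have := om_comb x y a b 1 0; have := om_comb x y a b 0 1.
rewrite !scale1r !scale0r addr0 add0r => -> ->.
rewrite !mulr0 !mulr1 subr0 sub0r => /eqP; rewrite mulf_eq0 (negPf xy) orbF.
move=> /eqP -> /eqP; rewrite mulf_eq0 (negPf xy) orbF oppr_eq0 => /eqP ->.
by rewrite !scale0r addr0.
Qed.

End Planes.

Section Pointwise.
Variables (R : realType) (m : nat) (M : smooth_manifold R m).
Local Notation E := 'rV[R]_m.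
Variables (Om : tensor2 M) (D : connection M) (p : M).
Hypothesis omxx : forall x, Om p x x = 0.
Hypothesis tf : torsion_free D.

(** Numerator and denominator of the sectional form are alternating in the basis
    of the plane, so that a change of basis multiplies both by its determinant. *)
Lemma sectionalE (L : {vspace E}) x y z : \dim L = 2%N ->
  x \in L -> y \in L -> Om p x y != 0 ->
  curvature4 Om D p x y z z = Om p x y * sectional Om D p L z.
Proof.
move=> dL xL yL xy; have [_ _ _ dec] := plane_basis dL.
rewrite /sectional; move: (vbasis L)`_0 (vbasis L)`_1 dec => X0 X1 dec.
have [a [b ex]] := dec _ xL; have [c [d ey]] := dec _ yL.
have e1 : Om p x y = (a * d - b * c) * Om p X0 X1 by rewrite ex ey om_comb.
have X01 : Om p X0 X1 != 0 by apply: contra_neq xy => e; rewrite e1 e mulr0.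
have e2 : curvature4 Om D p x y z z = (a * d - b * c) * curvature4 Om D p X0 X1 z z.
  rewrite ex ey; apply: (@alternating_comb R m (fun u v => curvature4 Om D p u v z z)).
    by move=> s u u' v; apply: (@curv4_linear1 R m (Om p) (curvature D p)); exact: (curvature_linear1 tf).
  by move=> u v; apply: (@curv4_anti R m (Om p) (curvature D p)); exact: (curvature_anti tf).
by rewrite e1 e2 -mulrA; congr (_ * _); rewrite [RHS]mulrC divfK.
Qed.

End Pointwise.

(** * Weyl flatness and the sectional form *)

Section SectionalForm.
Variables (R : realType) (n : nat) (M : smooth_manifold R (2 * n)).
Local Notation E := 'rV[R]_(2 * n).
Variables (Om : tensor2 M) (D : connection M).
Hypothesis Om_symplectic : symplectic_form Om.
Hypothesis D_symplectic : symplectic_connection Om D.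

Let tf : torsion_free D := D_symplectic.1.
Let omxx p x : Om p x x = 0. Proof. by have [h _ _] := Om_symplectic. Qed.
Let nondeg p x : (forall y, Om p x y = 0) -> x = 0.
Proof. by have [_ h _] := Om_symplectic; exact: h. Qed.
Let skew p x y z u : Om p (curvature D p x y z) u = - Om p z (curvature D p x y u).
Proof. exact (curvature_skew tf D_symplectic.2 p x y z u). Qed.

Lemma ricci_sym p x y : ricci D p x y = ricci D p y x.
Proof.
exact (ric_sym (@nondeg p) (curvature_linear3 tf p) (curvature_anti tf p)
  (bianchi tf p) (skew p) x y).
Qed.

Definition sectional_eq (A : tensor2 M) :=
  forall (p : M) (L : {vspace E}), \dim L = 2%N -> symplectic_subspace Om p L ->
    forall Z, Z \in L -> sectional Om D p L Z = 4 * A p Z Z.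

Lemma curvature_of_sectional A p x y : sectional_eq A -> Om p x y != 0 ->
  curvature4 Om D p x y x x = 4 * Om p x y * A p x x.
Proof.
move=> sA xy; have [dL xL yL sL] := span_plane (@omxx p) xy.
by rewrite (sectionalE (@omxx p) tf x dL xL yL xy) (sA _ _ dL sL _ xL) mulrCA mulrA.
Qed.

Lemma ricci_of_sectional A p x y : symmetric2 A -> sectional_eq A ->
  ricci D p x y = (2 * n + 2)%:R * A p x y.
Proof.
move=> symA sA.
exact (ric_formula (@omxx p) (@nondeg p) (curvature_linear1 tf p) (curvature_linear3 tf p)
  (curvature_anti tf p) (bianchi tf p) (skew p) (symA p)
  (fun x y => curvature_of_sectional (x := x) (y := y) sA) x y).
Qed.

(** With [2 * (n + 1) A] in place of the Ricci tensor, the Weyl tensor is the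
    difference of the two sides of [curv4_formula]. *)
Lemma weyl_flat_of_sectional A : symmetric2 A -> sectional_eq A -> weyl_flat Om D.
Proof.
move=> symA sA p x y z u; rewrite /weyl /=.
have := curv4_formula (@omxx p) (@nondeg p) (curvature_linear1 tf p) (curvature_linear3 tf p)
  (curvature_anti tf p) (bianchi tf p) (skew p) (symA p)
  (fun x y => curvature_of_sectional (x := x) (y := y) sA) x y z u.
rewrite /curv4 -/(curvature4 Om D p x y z u) => ->.
rewrite !(ricci_of_sectional _ _ _ symA sA) (om_anti (@omxx p) y z) (om_anti (@omxx p) y u).
rewrite (symA p u y) (symA p z y) (symA p u x) (symA p z x).
have -> : (2 * n + 2)%:R = 2 * n.+1%:R :> R by rewrite -natrM mulnS addnC.
move: (Om p x y) (Om p x z) (Om p x u) (Om p y z) (Om p y u) => *.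
have : n.+1%:R != 0 :> R by rewrite pnatr_eq0.
by move: n.+1%:R => N N0; field.
Qed.

(** For Z = a X + b Y in the plane, Om(X, Z) = b Om(X, Y) and
    Om(Y, Z) = - a Om(X, Y), so that each of the two groups of terms that make up
    the curvature of a Weyl flat connection gives Om(X, Y) Ric(Z, Z) / (n + 1). *)
Lemma sectional_of_weyl_flat : weyl_flat Om D ->
  sectional_eq (ricci_tensor tf (2 * n.+1%:R)^-1).
Proof.
move=> W p L dL sL Z ZL; have [xL yL x0 dec] := plane_basis dL.
have xy : Om p (vbasis L)`_0 (vbasis L)`_1 != 0.
  apply: contra_neq x0 => e; apply: (sL _ xL) => v /dec[a [b ->]].
  by rewrite linearDr !linearZr_LR /= omxx e !mulr0 addr0.
rewrite ricci_tensorE; have := W p (vbasis L)`_0 (vbasis L)`_1 Z Z; rewrite /weyl /=.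
rewrite (sectionalE (@omxx p) tf Z dL xL yL xy).
have [a [b eZ]] := dec Z ZL.
move: (vbasis L)`_0 (vbasis L)`_1 xy eZ => x y xy eZ.
have e1 : Om p x Z = b * Om p x y.
  by rewrite eZ linearDr !linearZr_LR /= omxx mulr0 add0r.
have e2 : Om p y Z = - (a * Om p x y).
  by rewrite eZ linearDr !linearZr_LR /= omxx mulr0 addr0 (om_anti (@omxx p) x) mulrN.
have e3 : ricci D p Z Z = a * ricci D p Z x + b * ricci D p Z y.
  rewrite {2}eZ (ricci_linear2 tf); congr (_ + _).
  have e0 : ricci D p Z 0 = 0.
    have := ricci_linear2 tf p 1 Z 0 0; rewrite scale1r addr0.
    by move: (ricci D p Z 0) => r h; lra.
  by have := ricci_linear2 tf p b Z y 0; rewrite !addr0 e0 addr0.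
rewrite e1 e2 e3.
move: (ricci D p Z x) (ricci D p Z y) (sectional _ _ _ _ _) (Om p x y) xy => r s S o o0.
have n0 : n.+1%:R != 0 :> R by rewrite pnatr_eq0.
move: n.+1%:R n0 => N N0.
move=> h; apply: (mulfI o0); apply/eqP; rewrite -subr_eq0 -[X in _ == X]h.
by apply/eqP; field.
Qed.

End SectionalForm.

Unset Implicit Arguments.
Set Strict Implicit.

Theorem theorem4p1 (R : realType) (n : nat) (hn : (0 < n)%N)
    (M : smooth_manifold R (2 * n)) (M_connected : connected [set: M])
    (Om : tensor2 M) (Om_symplectic : symplectic_form Om)
    (D : connection M) (D_symplectic : symplectic_connection Om D) :
  let sectional_eq (A : tensor2 M) :=
    forall (p : M) (L : {vspace 'rV[R]_(2 * n)}),
      \dim L = 2%N -> symplectic_subspace Om p L ->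
      forall Z, Z \in L -> sectional Om D p L Z = 4 * A p Z Z in
  (weyl_flat Om D <-> exists A : tensor2 M, symmetric2 A /\ sectional_eq A) /\
  (forall A : tensor2 M, symmetric2 A -> sectional_eq A ->
     forall (p : M) (X Y : 'rV[R]_(2 * n)),
       (2 * (n + 1))%:R * A p X Y = ricci D p X Y).
Proof.
move=> /=; split; first split.
- move=> W; exists (ricci_tensor D_symplectic.1 (2 * n.+1%:R)^-1); split.
    move=> p x y; exact (congr1 _ (ricci_sym Om_symplectic D_symplectic p x y)).
  exact (sectional_of_weyl_flat Om_symplectic D_symplectic W).
- move=> [A [symA sA]].
  exact (weyl_flat_of_sectional Om_symplectic D_symplectic symA sA).
- move=> A symA sA p x y.
  by rewrite (ricci_of_sectional Om_symplectic D_symplectic p x y symA sA) mulnDr muln1.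
Qed.
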